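(* Let $\Bbbk$ be a field, $M\subseteq\mathbb{Z}^q_{\geq0}$ an affine monoid, and $R=\Bbbk[M]$. If $\operatorname{char}(\Bbbk)\in\mathcal{A}(M)$, then $\operatorname{mpr}(M)$ is the $F$-splitting ratio of $R$. As a consequence, if $\operatorname{char}(\Bbbk)$ is a prime number and $M$ is normal, then $\operatorname{mps}(M)$ is equal to the $F$-signature of $R$.
   Context: An affine monoid $M\subseteq\mathbb{Z}^q_{\geq 0}$ ($q$ a positive integer) is a finitely generated submonoid of $\mathbb{Z}^q$ contained in $\mathbb{Z}^q_{\geq0}$. $\mathbb{Z}M$ is the group generated by $M$, $C(M)=\mathbb{R}_{\geq0}M$ is the cone generated by $M$, and the rank of a monoid $N$ is $\dim_{\mathbb{Q}}(\mathbb{Q}\otimes_{\mathbb{Z}}\mathbb{Z}N)$. $M$ is normal if $C(M)\cap\mathbb{Z}M=M$. With $\frac1mM=\{\gamma/m:\gamma\in M\}$, set $\mathcal{A}(M)=\{m\in\mathbb{Z}_{>1}\mid\frac1mM\cap\mathbb{Z}M=M\}$ (nonempty, and then infinite, exactly when $M$ is seminormal, i.e. when $\alpha\in\mathbb{Z}M$ and $2\alpha,3\alpha\in M$ imply $\alpha\in M$). For an integer $m>1$, $$V_m(M)=\left\{\alpha\in\tfrac1mM \;\middle|\; \left(\tfrac1mM-\alpha\right)\cap\mathbb{Z}M\subseteq M\right\}.$$ The pure prime of $M$ is $\mathcal{P}(M)=M\setminus\bigcup_{m>1}mV_m(M)$; there is a face $\mathcal{F}_M$ of $C(M)$ with $M\setminus\mathcal{P}(M)=M\cap\mathcal{F}_M$,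 and $\operatorname{mpdim}(M)=\operatorname{rank}(M\cap\mathcal{F}_M)$. For $M$ seminormal, $s=\operatorname{mpdim}(M)$ and $\{m_t\}_{t\geq1}$ the elements of $\mathcal{A}(M)$ ordered increasingly, $$\operatorname{mpr}(M)=\lim_{t\to\infty}\frac{|V_{m_t}(M)|}{m_t^{s}},\qquad \operatorname{mps}(M)=\lim_{t\to\infty}\frac{|V_{m_t}(M)|}{m_t^{\operatorname{rank}(M)}}.$$ $\Bbbk[M]$ is the affine semigroup ring with $\Bbbk$-basis the monomials $\mathbf{x}^\alpha$, $\alpha\in M$; $\mathfrak{m}$ is its homogeneous maximal ideal, generated by $\mathbf{x}^\alpha$ with $0\neq\alpha\in M$. For $p=\operatorname{char}(\Bbbk)>0$ and $e\geq1$, with $R^{1/p^e}$ the ring of $p^e$-th roots of elements of $R$, let $I_e=\{f\in R\mid\phi(f^{1/p^e})\in\mathfrak{m}\ \text{for all }\phi\in\operatorname{Hom}_R(R^{1/p^e},R)\}$. The splitting prime is $P=\bigcap_eI_e$ and the splitting dimension is $\operatorname{sdim}(R)=\dim(R/P)$. The $F$-splitting ratio of $R$ is $\lim_{e\to\infty}\dim_{\Bbbk}(R/I_e)/p^{e\,\operatorname{sdim}(R)}$, and the $F$-signature of $R$ is $\lim_{e\to\infty}\dim_{\Bbbk}(R/I_e)/p^{e\dim(R)}$. *)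

(* Defs.v *)
From HB Require Import structures.
From mathcomp Require Import all_boot all_order all_algebra finmap.
From mathcomp Require Import all_classical all_reals all_analysis.
From mathcomp Require monalg.
(* The notations of monalg clash with those of mathcomp-analysis. *)
Import -(notations) monalg.

Set Implicit Arguments.
Unset Strict Implicit.
Unset Printing Implicit Defensive.

Import Order.TTheory GRing.Theory Num.Theory.
Import numFieldNormedType.Exports.

Local Open Scope classical_set_scope.
Local Open Scope ring_scope.

Definition submonoid (V : zmodType) (A : set V) : Prop :=
  A 0 /\ forall x y, A x -> A y -> A (x + y).

Definition subgroup (V : zmodType) (A : set V) : Prop :=
  A 0 /\ forall x y, A x -> A y -> A (x - y).

Record affine_monoid (q : nat) := AffineMonoid {
  am_set :> set 'rV[int]_q;
  am_ge0 : forall x, am_set x -> forall i, 0 <= x ord0 i;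
  am_fg : exists s : seq 'rV[int]_q,
    am_set = smallest (@submonoid 'rV[int]_q) [set` s]
}.

Section MonoidInvariants.
Variable q : nat.
Implicit Types (A N : set 'rV[int]_q) (M : affine_monoid q).

Definition toQ (x : 'rV[int]_q) : 'rV[rat]_q := map_mx intr x.

Definition toR (R : realType) (x : 'rV[int]_q) : 'rV[R]_q := map_mx intr x.
Arguments toR R x : clear implicits.

Definition group_gen A : set 'rV[int]_q :=
  smallest (@subgroup 'rV[int]_q) A.

(* Q (x) ZN, identified by flatness of Q with the Q-span of ZN in Q^q. *)
Definition Qspan N : {vspace 'rV[rat]_q} :=
  xget 0%VS [set U : {vspace 'rV[rat]_q} |
    (forall x, group_gen N x -> toQ x \in U) /\
    (forall W : {vspace 'rV[rat]_q},
       (forall x, group_gen N x -> toQ x \in W) -> (U <= W)%VS)].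

Definition mrank N : nat := \dim (Qspan N).

Definition cone (R : realType) A : set 'rV[R]_q :=
  [set x | exists (n : nat) (c : 'I_n -> R) (v : 'I_n -> 'rV[int]_q),
     [/\ forall i, 0 <= c i, forall i, A (v i)
       & x = \sum_(i < n) c i *: toR R (v i)]].
Arguments cone : clear implicits.

Definition normal_monoid (R : realType) M : Prop :=
  cone R M `&` [set toR R x | x in group_gen M] = [set toR R x | x in M].

Definition divM (m : nat) M : set 'rV[rat]_q :=
  [set m%:R^-1 *: toQ x | x in M].

Definition Aset M : set nat :=
  [set m | (1 < m)%N /\
     divM m M `&` [set toQ x | x in group_gen M] = [set toQ x | x in M]].

Definition Vset (m : nat) M : set 'rV[rat]_q :=
  [set a | divM m M a /\
     [set b - a | b in divM m M] `&` [set toQ x | x in group_gen M]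
       `<=` [set toQ x | x in M]].

(* Vset m M is finite for every m > 1, since M has no nonzero unit. *)
Definition cardV (m : nat) M : nat := #|` fset_set (Vset m M)|%fset.

Definition pure_prime M : set 'rV[int]_q :=
  M `\` \bigcup_(m in [set m | (1 < m)%N])
          [set x | [set m%:R *: a | a in Vset m M] (toQ x)].

(* Faces are cut out by supporting hyperplanes; h = 0 gives C itself. *)
Definition face (R : realType) (C F : set 'rV[R]_q) : Prop :=
  exists h : 'cV[R]_q,
    (forall x, C x -> 0 <= (x *m h) ord0 ord0) /\
    F = C `&` [set x | (x *m h) ord0 ord0 = 0].

Definition pure_face (R : realType) M : set 'rV[R]_q :=
  xget set0 [set F | face (cone R M) F /\
    M `\` pure_prime M = M `&` [set x | F (toR R x)]].
Arguments pure_face : clear implicits.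

Definition mpdim (R : realType) M : nat :=
  mrank (M `&` [set x | pure_face R M (toR R x)]).

(* The t-th smallest element of B, starting from t = 0. *)
Definition nth_elt (B : set nat) (t : nat) : nat :=
  xget 0%N [set m | B m /\ #|[set i : 'I_m | `[< B i >]]%SET| = t].

Definition mpr_seq (R : realType) M : R^nat := fun t =>
  (cardV (nth_elt (Aset M) t) M)%:R / (nth_elt (Aset M) t)%:R ^+ mpdim R M.

Definition mps_seq (R : realType) M : R^nat := fun t =>
  (cardV (nth_elt (Aset M) t) M)%:R / (nth_elt (Aset M) t)%:R ^+ mrank M.

Definition mpr (R : realType) M : R := limn (mpr_seq R M).

Definition mps (R : realType) M : R := limn (mps_seq R M).

End MonoidInvariants.

Arguments cone {q} R A.
Arguments pure_face {q} R M.

Section Exponents.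
Variables (q : nat) (M : affine_monoid q).

Lemma am0 : am_set M 0.
Proof. by have [s ->] := am_fg M => N [[N0 _] _]. Qed.

Lemma amD x y : am_set M x -> am_set M y -> am_set M (x + y).
Proof.
have [s ->] := am_fg M => Mx My N NP.
by case: (NP) => -[_ ND] _; apply: ND; [apply: Mx|apply: My].
Qed.

Record expo := Expo { expo_val :> 'rV[int]_q; _ : `[< am_set M expo_val >] }.

HB.instance Definition _ := [isSub for expo_val].
HB.instance Definition _ := [Choice of expo by <:].

Lemma expoP (a : expo) : am_set M (expo_val a).
Proof. by case: a => x /= /asboolP. Qed.

Definition expo0 : expo := Expo (asboolT am0).
Definition expoD (a b : expo) : expo := Expo (asboolT (amD (expoP a) (expoP b))).

Fact expoDA : associative expoD.
Proof. by move=> a b c; apply: val_inj; rewrite /= addrA. Qed.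

Fact expo0D : left_id expo0 expoD.
Proof. by move=> a; apply: val_inj; rewrite /= add0r. Qed.

Fact expoD0 : right_id expo0 expoD.
Proof. by move=> a; apply: val_inj; rewrite /= addr0. Qed.

Fact expoDC : commutative expoD.
Proof. by move=> a b; apply: val_inj; rewrite /= addrC. Qed.

Fact expoD_eq0 a b : expoD a b = expo0 -> a = expo0 /\ b = expo0.
Proof.
move=> /(congr1 expo_val) /= /rowP ab0.
have ge0 (c : expo) i : 0 <= expo_val c ord0 i by apply: am_ge0; exact: expoP.
by split; apply: val_inj; apply/rowP => i /=; have := ab0 i; rewrite !mxE => /eqP;
  rewrite paddr_eq0 // => /andP[/eqP ? /eqP ?].
Qed.

(* monalg writes its monoids multiplicatively: the product is the sum in M. *)
HB.instance Definition _ :=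
  Choice_isMonomialDef.Build expo expoDA expo0D expoD0 expoD_eq0.
HB.instance Definition _ := MonomialDef_isConomialDef.Build expo expoDC.

End Exponents.

Notation sgring k M := (malg (expo M) k).

Definition ideal (R : comNzRingType) (I : set R) : Prop :=
  I 0 /\ forall a x y : R, I x -> I y -> I (a * x + y).

Definition hmax (k : fieldType) (q : nat) (M : affine_monoid q) :
    set (sgring k M) :=
  smallest (@ideal (sgring k M))
    [set (mkmalgU a 1 : sgring k M) | a in [set a : expo M | a != expo0 M]].

Section FrobeniusRoot.
Variables (R : comNzRingType) (p : nat) (chRp : p \in [pchar R]) (e : nat).

(* R^{1/p^e} for R reduced: a copy of R in which f stands for f^{1/p^e}; the
   inclusion of R is r = (r^{p^e})^{1/p^e}. *)
Definition froot of p \in [pchar R] & nat : Type := R.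
Local Notation S := (froot chRp e).

HB.instance Definition _ := GRing.ComNzRing.on S.

Definition to_root (f : R) : S := f.

Definition froot_scale (r : R) (f : S) : S := to_root (r ^+ (p ^ e)) * f.

Fact froot_scaleA a b v :
  froot_scale a (froot_scale b v) = froot_scale (a * b) v.
Proof. by rewrite /froot_scale /to_root exprMn mulrA. Qed.

Fact froot_scale1 : left_id 1 froot_scale.
Proof. by move=> v; rewrite /froot_scale /to_root expr1n mul1r. Qed.

Fact froot_scaleDr : right_distributive froot_scale +%R.
Proof. by move=> a u v; rewrite /froot_scale mulrDr. Qed.

Fact froot_scaleDl v : {morph froot_scale^~ v : a b / a + b}.
Proof.
move=> a b; rewrite /froot_scale /to_root -mulrDl; congr (_ * _).
by rewrite exprDn_pchar // pnatX pnatE ?chRp // (pcharf_prime chRp).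
Qed.

HB.instance Definition _ := GRing.Zmodule_isLmodule.Build R S
  froot_scaleA froot_scale1 froot_scaleDr froot_scaleDl.

Fact froot_scaleAl (a : R) (u v : S) : a *: (u * v) = a *: u * v.
Proof. exact: mulrA. Qed.

HB.instance Definition _ := GRing.Lmodule_isLalgebra.Build R S froot_scaleAl.

Lemma to_rootX (f : R) : to_root f ^+ (p ^ e) = f%:A.
Proof. by rewrite /GRing.scale /= /froot_scale mulr1. Qed.

End FrobeniusRoot.

Section Splitting.
Variables (R : comNzRingType) (m : set R) (p : nat) (chRp : p \in [pchar R]).

Definition split_ideal (e : nat) : set R :=
  [set f | forall phi : {linear froot chRp e -> R^o}, m (phi (to_root chRp e f))].

Definition split_prime : set R :=
  \bigcap_(e in [set e | (0 < e)%N]) split_ideal e.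

End Splitting.

Definition prime_ideal (R : comNzRingType) (I : set R) : Prop :=
  [/\ ideal I, ~ I 1 & forall x y, I (x * y) -> I x \/ I y].

(* Primes of R/I are given as primes of R containing I. *)
Definition prime_chain (R : comNzRingType) (I : set R) (n : nat) : Prop :=
  exists c : nat -> set R,
    [/\ forall i, (i <= n)%N -> prime_ideal (c i) /\ I `<=` c i
      & forall i, (i < n)%N -> c i `<` c i.+1].

(* The Krull dimension of R/I (0 if there is no longest chain). *)
Definition krull_dim (R : comNzRingType) (I : set R) : nat :=
  xget 0%N [set n | prime_chain I n /\ forall n', prime_chain I n' -> (n' <= n)%N].

Definition quot_basis (k : fieldType) (W : lmodType k) (I : set W) (n : nat)
    (b : 'I_n -> W) : Prop :=
  (forall c : 'I_n -> k, I (\sum_(i < n) c i *: b i) -> forall i, c i = 0) /\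
  (forall f, exists c : 'I_n -> k, I (f - \sum_(i < n) c i *: b i)).

(* dim_k (W/I) for a subspace I of W (0 if infinite). *)
Definition quot_dim (k : fieldType) (W : lmodType k) (I : set W) : nat :=
  xget 0%N [set n | exists b : 'I_n -> W, quot_basis I b].

Section SemigroupRing.
Variables (k : fieldType) (q : nat) (M : affine_monoid q) (p : nat).

Lemma pchar_sgring : p \in [pchar k] -> p \in [pchar (sgring k M)].
Proof. by rewrite pchar_lalg. Qed.

Variable chkp : p \in [pchar k].
Let chRp := pchar_sgring chkp.

Definition sdim : nat := krull_dim (split_prime (@hmax k q M) chRp).

Definition ring_dim : nat := krull_dim ([set 0] : set (sgring k M)).

Definition split_codim (e : nat) : nat :=
  quot_dim (split_ideal (@hmax k q M) chRp e).

Definition fsplit_seq (K : realType) : K^nat := fun e =>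
  (split_codim e)%:R / p%:R ^+ (e * sdim).

Definition fsig_seq (K : realType) : K^nat := fun e =>
  (split_codim e)%:R / p%:R ^+ (e * ring_dim).

Definition F_splitting_ratio (K : realType) : K := limn (fsplit_seq K).

Definition F_signature (K : realType) : K := limn (fsig_seq K).

End SemigroupRing.

(* Main.v *)
From HB Require Import structures.
Require Import Defs.
From mathcomp Require Import all_boot all_order all_algebra finmap.
From mathcomp Require Import all_classical all_reals all_analysis.
From mathcomp Require Import zify ring lra.
From mathcomp Require monalg mpoly.
(* The notations of monalg and mpoly clash with those of mathcomp-analysis. *)
Import (canonicals) mpoly.
Import -(notations) monalg.

(* Put W_m = m V_m(M), the set of a in M such that a + m g in M implies g in M
   for every g in ZM, and N = U_{m > 1} W_m.

   Counting.  W_m is divisor closed, and a in W_m, b in W_n give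
   a + m b in W_{mn}; so N is a divisor closed submonoid, i.e. M intersected
   with a face of C(M) (Gordan's theorem), and mpdim(M) = s = rank N.  Fix
   independent g_1, ..., g_s in N, with sum g and index d in ZN.  If n is in A(M),
   c m <= n and c is prime to d, then (b, y) |-> c b - (y_1 g_1 + ... + y_s g_s),
   0 <= y_i < c, is injective, and it maps the b in W_m with b - g in M into W_n.
   All but O(m^(s-1)) elements b of W_m are of this kind.  Hence
   w(m) = |W_m| / m^s satisfies w(m) <= w(n) + K/m + C m/n for m <= n in A(M),
   and converges to sup_m (w(m) - K/m), without any appeal to volumes.

   Algebra.  I_e is spanned by the monomials x^a with a not in W_{p^e}, so
   dim R/I_e = |W_{p^e}|.  As W_m is monotone in m in A(M), the splitting prime is
   spanned by the monomials outside N, and R/P = k[N] has dimension rank N: chains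
   of primes are bounded by a count of monomials, and the kernels of the
   successive coordinate projections of k[N] reach the bound. *)

Set Implicit Arguments.
Unset Strict Implicit.
Unset Printing Implicit Defensive.

Import Order.TTheory GRing.Theory Num.Theory.
Import numFieldNormedType.Exports.

Local Open Scope classical_set_scope.
Local Open Scope ring_scope.

(** * The sets [m V_m(M)] *)

Section Combinatorics.
Variables (q : nat) (M : affine_monoid q).
Implicit Types (a b g x y : 'rV[int]_q) (m n : nat).

Definition wset m : set 'rV[int]_q :=
  [set a | am_set M a /\ forall g, group_gen M g -> am_set M (a + g *+ m) -> am_set M g].

Definition face_monoid : set 'rV[int]_q :=
  \bigcup_(m in [set m | (1 < m)%N]) wset m.

Definition divisor_closed (N : set 'rV[int]_q) : Prop :=
  submonoid N /\ forall a b, am_set M a -> am_set M b -> N (a + b) -> N a.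

Lemma submonoidMn (N : set 'rV[int]_q) x n : submonoid N -> N x -> N (x *+ n).
Proof.
move=> [N0 ND] Nx; elim: n => [|n IH]; first by rewrite mulr0n.
by rewrite mulrS; exact: ND.
Qed.

Lemma submonoid_sum (N : set 'rV[int]_q) (I : Type) (r : seq I) (P : pred I) F :
  submonoid N -> (forall i, P i -> N (F i)) -> N (\sum_(i <- r | P i) F i).
Proof. by move=> [N0 ND] NF; elim/big_rec: _ => // i x /NF; exact: ND. Qed.

Lemma submonoid_am : submonoid M.
Proof. by split; [exact: am0 | exact: amD]. Qed.

Lemma amMn x n : am_set M x -> am_set M (x *+ n).
Proof. exact: submonoidMn submonoid_am. Qed.

Lemma am_opp_eq0 x : am_set M x -> am_set M (- x) -> x = 0.
Proof.
move=> Mx MNx; apply/rowP => i; rewrite mxE; apply/eqP.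
rewrite eq_le (am_ge0 Mx) andbT -oppr_ge0.
by have := am_ge0 MNx i; rewrite mxE.
Qed.

Lemma group_genP (N : set 'rV[int]_q) x : submonoid N ->
  group_gen N x <-> exists u v, [/\ N u, N v & x = u - v].
Proof.
move=> [N0 ND]; split.
  apply: (@smallest_sub _ _ _ [set x | exists u v, [/\ N u, N v & x = u - v]]).
    split; first by exists 0, 0; rewrite subr0.
    move=> _ _ [u [v [Nu Nv ->]]] [u' [v' [Nu' Nv' ->]]].
    by exists (u + v'), (v + u'); split; rewrite ?opprB ?opprD; [exact: ND..|rewrite addrACA].
  by move=> y Ny; exists y, 0; rewrite subr0.
move=> [u [v [Nu Nv ->]]] H [[H0 HB] NH].
by apply: HB; exact: NH.
Qed.

Lemma group_gen_sub (N : set 'rV[int]_q) : N `<=` group_gen N.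
Proof. by move=> x Nx H [_]; apply. Qed.

Lemma group_genB (N : set 'rV[int]_q) x y :
  group_gen N x -> group_gen N y -> group_gen N (x - y).
Proof.
move=> Nx Ny H HP; case: (HP) => -[_ HB] _.
by apply: HB; [exact: Nx | exact: Ny].
Qed.

(** Discarding zero and repetitions from the generators lets [wset_coef] bound every coefficient,
    and lets coefficients be indexed by the generators themselves. *)
Lemma am_generators : exists s : seq 'rV[int]_q,
  [/\ uniq s, forall y, y \in s -> am_set M y /\ y <> 0
    & forall x, am_set M x -> exists c : 'rV[int]_q -> nat,
        x = \sum_(y <- s) y *+ c y].
Proof.
have [s0 Ms0] := am_fg M; pose s := undup [seq y <- s0 | y != 0].
have us : uniq s by rewrite undup_uniq.
exists s; split=> //.
  move=> y; rewrite mem_undup mem_filter => /andP[/eqP yn0 ys0]; split=> //.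
  by rewrite Ms0 => N [_]; apply.
rewrite Ms0; apply: smallest_sub.
  split; first by exists (fun=> 0%N); rewrite big1.
  move=> _ _ [c ->] [d ->]; exists (fun y => c y + d y)%N.
  by rewrite -big_split; apply: eq_bigr => y _; rewrite mulrnDr.
move=> y /= ys0; have [->|yn0] := eqVneq y 0.
  by exists (fun=> 0%N); rewrite big1.
have ys : y \in s by rewrite mem_undup mem_filter yn0.
exists (fun z => (z == y) : nat); rewrite (bigD1_seq y) //= eqxx mulr1n.
by rewrite big1 ?addr0 // => z /negPf ->; rewrite mulr0n.
Qed.

Lemma wset_am m : wset m `<=` M. Proof. by move=> a []. Qed.

Lemma face_monoid_am : face_monoid `<=` M.
Proof. by move=> a [m _ []]. Qed.

Lemma wset_dvd m a b : am_set M a -> am_set M b -> wset m (a + b) -> wset m a.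
Proof.
move=> Ma Mb [_ Wab]; split=> // g Gg Mag; apply: Wab => //.
by rewrite addrAC; exact: amD.
Qed.

(** Since [a + m b + m n g = a + m (b + n g)], membership of [a] puts [b + n g] in M, and then
    membership of [b] puts [g] in M. *)
Lemma wsetD m n a b : wset m a -> wset n b -> wset (m * n) (a + b *+ m).
Proof.
move=> [Ma Wa] [Mb Wb]; split; first by apply: amD => //; exact: amMn.
move=> g Gg; rewrite -addrA mulnC mulrnA -mulrnDl => Mabg.
apply: (Wb g) => //; apply: Wa => //.
have [u [v [Mu Mv guv]]] := (group_genP _ submonoid_am).1 Gg.
apply/(group_genP _ submonoid_am); exists (b + u *+ n), (v *+ n); split.
- by apply: amD => //; exact: amMn.
- exact: amMn.
- by rewrite guv mulrnBl addrA.
Qed.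

Lemma divisor_closed_face m : (1 < m)%N -> wset m 0 -> divisor_closed face_monoid.
Proof.
move=> m_gt1 W0; split; last first.
  by move=> a b Ma Mb [n n_gt1 Wab]; exists n => //; apply: wset_dvd Wab.
split; first by exists m.
move=> a b [n n_gt1 Wa] [n' n'_gt1 Wb]; exists (n * n')%N.
  by rewrite /= (leq_trans n_gt1) // leq_pmulr // ltnW.
(* [wsetD] gives [a + n b] rather than [a + b]; the surplus [(n - 1) b] is removed by divisor
   closure. *)
apply: (@wset_dvd _ _ (b *+ n.-1)).
- by apply: amD; [case: Wa|case: Wb].
- by apply: amMn; case: Wb.
- by rewrite -addrA -mulrS prednK ?(ltnW n_gt1) //; apply: wsetD.
Qed.

Lemma divisor_closed_am : divisor_closed M.
Proof. by split=> //; exact: submonoid_am. Qed.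

(* [m (c b + n g) + (n - c m) b = n (b + m g)], and [n] may be cancelled. *)
Lemma wset_scale m n c b : wset n 0 -> wset m b -> (c * m <= n)%N ->
  wset n (b *+ c).
Proof.
move=> [_ W0] [Mb Wb] cmn; split; first exact: amMn.
move=> g Gg Mbg; apply: Wb => //; apply: W0.
  have [u [v [Mu Mv guv]]] := (group_genP _ submonoid_am).1 Gg.
  apply/(group_genP _ submonoid_am); exists (b + u *+ m), (v *+ m); split.
  - by apply: amD => //; exact: amMn.
  - exact: amMn.
  - by rewrite guv mulrnBl addrA.
have -> : 0 + (b + g *+ m) *+ n =
          (b *+ c + g *+ n) *+ m + b *+ (n - c * m).
  rewrite add0r !mulrnDl -!mulrnA [(n * m)%N]mulnC addrAC -mulrnDr.
  by rewrite subnKC.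
by apply: amD; apply: amMn.
Qed.

Lemma wset_mono m n : wset n 0 -> (m <= n)%N -> wset m `<=` wset n.
Proof. by move=> W0 mn b Wb; rewrite -[b]mulr1n; apply: wset_scale Wb _; rewrite ?mul1n. Qed.

Lemma wset0M m n : wset m 0 -> wset n 0 -> wset (m * n) 0.
Proof. by move=> Wm Wn; have := wsetD Wm Wn; rewrite mul0rn addr0. Qed.

Lemma wset0X m e : wset m 0 -> wset (m ^ e.+1) 0.
Proof.
by move=> Wm; elim: e => [|e IH]; rewrite ?expn1 // expnS; exact: wset0M.
Qed.

(** A coefficient at least [m] at [y] would allow [m y] to be subtracted within M; taking [g = - y]
    then makes [y] a unit, and 0 is the only unit of M. *)
Lemma wset_coef s m (c : 'rV[int]_q -> nat) : uniq s ->
  (forall y, y \in s -> am_set M y /\ y <> 0) -> wset m (\sum_(y <- s) y *+ c y) ->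
  forall y, y \in s -> (c y < m)%N.
Proof.
move=> us sM [_ W] y ys; rewrite ltnNge; apply/negP => mc.
have [My yn0] := sM y ys; apply: yn0.
apply: am_opp_eq0 => //; apply: W.
  by apply/(group_genP _ submonoid_am); exists 0, y; split; [exact: am0| |rewrite sub0r].
rewrite (bigD1_seq y) //= addrAC mulNrn -mulrnBr //; apply: amD.
  exact: amMn.
rewrite big_seq_cond; apply: submonoid_sum => [|z /andP[zs _]].
  exact: submonoid_am.
by apply: amMn; case: (sM z zs).
Qed.

(** The generators occur with coefficients below [m], so the sum of the absolute values of all their
    entries serves as [K]. *)
Lemma wset_bound : exists K : nat, forall m a, wset m a ->
  forall i, a ord0 i <= (K * m)%:Z.
Proof.
have [s [us sM sgen]] := am_generators.
exists (\sum_(y <- s) \sum_i `|y ord0 i|)%N => m a Wa i.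
have [c ac] := sgen a Wa.1; rewrite ac in Wa *.
rewrite summxE big_distrl.
have -> : ((\sum_(y <- s) (\sum_i `|y ord0 i|) * m)%N)%:Z =
   \sum_(y <- s) ((\sum_i `|y ord0 i|) * m)%N%:Z.
  by rewrite (big_morph Posz PoszD (erefl _)).
rewrite big_seq [leRHS]big_seq; apply: ler_sum => y ys.
rewrite mulmxnE.
have yc := wset_coef us sM Wa ys.
have y0 := am_ge0 (sM y ys).1 i.
have yi : y ord0 i <= (\sum_i `|y ord0 i|)%N%:Z.
  by rewrite (bigD1 i) //= PoszD -{1}(gez0_abs y0) lerDl.
apply: (le_trans (ler_wMn2r _ yi)).
by rewrite -mulr_natr natz lez_nat leq_mul // ltnW.
Qed.

Lemma finite_wset m : finite_set (wset m).
Proof.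
have [s [us sM sgen]] := am_generators.
pose f (t : {ffun 'I_(size s) -> 'I_m}) : 'rV[int]_q :=
  \sum_(i < size s) s`_i *+ t i.
apply: (@sub_finite_set _ _ (f @` [set: {ffun 'I_(size s) -> 'I_m}])); last first.
  exact/finite_image/finite_finset.
move=> a Wa; have [c ac] := sgen a Wa.1.
have cm : forall y, y \in s -> (c y < m)%N by apply: wset_coef; rewrite -?ac.
exists [ffun i : 'I_(size s) => Ordinal (cm _ (mem_nth 0 (ltn_ord i)))] => //.
by rewrite ac (big_nth 0) big_mkord; apply: eq_bigr => i _; rewrite ffunE.
Qed.

Definition wseq m : seq 'rV[int]_q := fset_set (wset m).

Lemma mem_wseq m a : (a \in wseq m) = (a \in wset m).
Proof. by rewrite in_fset_set //; exact: finite_wset. Qed.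

Lemma wseqP m a : reflect (wset m a) (a \in wseq m).
Proof. by rewrite mem_wseq; apply: (iffP idP); rewrite inE. Qed.

Lemma wseq_uniq m : uniq (wseq m).
Proof. exact: fset_uniq. Qed.

End Combinatorics.

(** * [A(M)], [V_m(M)] and the pure prime in terms of integral vectors *)

Section Translation.
Variables (q : nat) (M : affine_monoid q).
Implicit Types (a b g x y : 'rV[int]_q) (m n : nat).

Lemma toQ_inj : injective (@toQ q).
Proof.
move=> x y /rowP xy; apply/rowP => i; have := xy i; rewrite !mxE.
exact: intr_inj.
Qed.

Lemma toQMn x m : toQ (x *+ m) = m%:R *: toQ x.
Proof. by rewrite /toQ raddfMn scaler_nat. Qed.

Lemma toQB x y : toQ (x - y) = toQ x - toQ y.
Proof. exact: map_mxB. Qed.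

Lemma divMP m x : (0 < m)%N ->
  divM m M (toQ x) <-> am_set M (x *+ m).
Proof.
move=> m0; have mn0 : m%:R != 0 :> rat by rewrite pnatr_eq0 -lt0n.
split=> [[y My yx]|Mx].
  suff -> : x *+ m = y by [].
  by apply: toQ_inj; rewrite toQMn -yx scalerA divff ?scale1r.
by exists (x *+ m) => //; rewrite toQMn scalerA mulVf ?scale1r.
Qed.

(** M always lies in the intersection, so only the implication from [m g] in M to [g] in M is at
    stake, and this is the condition defining W_m at 0. *)
Lemma AsetP m : Aset M m <-> (1 < m)%N /\ wset M m 0.
Proof.
rewrite /Aset /=; split=> -[m1 H]; (split=> //).
  split; first exact: am0.
  move=> g Gg; rewrite add0r => Mg.
  have : [set toQ x | x in am_set M] (toQ g).
    by rewrite -H; split; [apply/divMP => //; exact: ltnW|exists g].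
  by move=> [y My /toQ_inj <-].
rewrite eqEsubset; split=> [_ [] /[swap] -[x Gx <-]|_ [x Mx <-]].
  move=> /(divMP _ (ltnW m1)) Mx; exists x => //.
  by apply: H.2 => //; rewrite add0r.
split; last by exists x => //; exact: group_gen_sub.
by apply/(divMP _ (ltnW m1)); exact: amMn.
Qed.

(** For [a = x / m], an element [g] of ZM lies in [M / m - a] exactly when [x + m g] lies in M. *)
Lemma VsetE m : (0 < m)%N ->
  Vset m M = [set m%:R^-1 *: toQ x | x in wset M m].
Proof.
move=> m0; have mn0 : m%:R != 0 :> rat by rewrite pnatr_eq0 -lt0n.
have mV0 : m%:R^-1 != 0 :> rat by rewrite invr_eq0.
rewrite eqEsubset; split=> [_ [[x Mx <-] H]|_ [x [Mx H] <-]].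
  exists x => //; split=> // g Gg Mxg.
  have : [set toQ x | x in am_set M] (toQ g).
    apply: H; split; last by exists g.
    exists (m%:R^-1 *: toQ (x + g *+ m)); first by exists (x + g *+ m).
    rewrite -scalerBr -toQB addrC addKr toQMn scalerA mulVf ?scale1r //.
  by move=> [y My /toQ_inj <-].
split; first by exists x.
move=> _ [[_ [y My <-] <-] [g Gg gE]]; exists g => //.
apply: H => //; suff -> : x + g *+ m = y by [].
have : m%:R *: toQ g = toQ (y - x).
  by rewrite gE -scalerBr toQB scalerA divff ?scale1r.
by rewrite -toQMn => /toQ_inj ->; rewrite addrC subrK.
Qed.

Lemma cardVE m : (0 < m)%N -> cardV m M = size (wseq M m).
Proof.
move=> m0; rewrite /cardV VsetE // fset_set_image; last exact: finite_wset.
rewrite card_imfset // => x y /scalerI; rewrite invr_eq0 pnatr_eq0 -lt0n.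
by move=> /(_ m0); exact: toQ_inj.
Qed.

Lemma pure_primeE : am_set M `\` pure_prime M = face_monoid M.
Proof.
have scale m x : (1 < m)%N ->
    [set m%:R *: a | a in Vset m M] (toQ x) <-> wset M m x.
  move=> m1; have m0 := ltnW m1.
  have mn0 : m%:R != 0 :> rat by rewrite pnatr_eq0 -lt0n.
  rewrite VsetE //; split.
    move=> [_ [y Wy <-]]; rewrite scalerA divff // scale1r.
    by move=> /toQ_inj <-.
  move=> Wx; exists (m%:R^-1 *: toQ x); first by exists x.
  by rewrite scalerA divff // scale1r.
rewrite /pure_prime setDD eqEsubset; split=> x.
  by move=> [Mx [m m1 /(scale _ _ m1) Wx]]; exists m.
move=> [m m1 Wx]; split; first exact: wset_am Wx.
by exists m => //; apply/(scale _ _ m1).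
Qed.

Lemma toR_inj (R : realType) : injective (@toR q R).
Proof.
move=> x y /rowP xy; apply/rowP => i; have := xy i; rewrite !mxE.
exact: intr_inj.
Qed.

(** If [m g] lies in M, then [g = (1/m) (m g)] lies in the cone and in ZM, hence in M by
    normality. *)
Lemma normal_Aset (R : realType) m : normal_monoid R M -> (1 < m)%N ->
  Aset M m.
Proof.
move=> nM m1; apply/AsetP; split=> //; split; first exact: am0.
move=> g Gg; rewrite add0r => Mg.
have : [set toR R x | x in am_set M] (toR R g); last by move=> [y My /toR_inj <-].
rewrite -nM; split; last by exists g.
exists 1%N, (fun=> m%:R^-1), (fun=> g *+ m); split=> [_|_|] //.
rewrite big_ord1 /toR raddfMn /= -[map_mx intr g *+ m]scaler_nat scalerA.
rewrite mulVf ?scale1r //.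
by rewrite pnatr_eq0 -lt0n ltnW.
Qed.

End Translation.

(** * The face of the pure prime *)

Lemma toQ_sum q (I : Type) (r : seq I) (P : pred I) (F : I -> 'rV[int]_q) :
  toQ (\sum_(i <- r | P i) F i) = \sum_(i <- r | P i) toQ (F i).
Proof. exact: raddf_sum. Qed.

Lemma toQMz q (x : 'rV[int]_q) (z : int) : toQ (x *~ z) = z%:~R *: toQ x.
Proof. by rewrite /toQ raddfMz scaler_int. Qed.

Lemma small_perturbation (F : realFieldType) n (a b : 'I_n -> F) :
  (forall i, 0 < a i) -> exists2 e, 0 < e & forall i, 0 < a i + e * b i.
Proof.
(* Each [(1 + |b i|) / a i] is at most [S], so [|b i| / S < a i]; the leading 1 keeps [S] positive
   when there are no indices. *)
move=> a0; pose S := 1 + \sum_i (1 + `|b i|) / a i.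
have t0 i : 0 <= (1 + `|b i|) / a i.
  by rewrite divr_ge0 ?addr_ge0 // ltW.
have S0 : 0 < S by rewrite ltr_pwDl // sumr_ge0.
exists S^-1; first by rewrite invr_gt0.
move=> i; suff : S^-1 * `|b i| < a i.
  have := ler_norm (- b i); rewrite normrN -subr_ge0 opprK => bi.
  have : 0 <= S^-1 * (`|b i| + b i) by rewrite mulr_ge0 // invr_ge0 ltW.
  by rewrite mulrDr; lra.
rewrite mulrC ltr_pdivrMr // -ltr_pdivrMl // mulrC.
apply: (@lt_le_trans _ _ ((1 + `|b i|) / a i)).
  by rewrite ltr_pM2r ?invr_gt0 // ltrDr.
by rewrite /S (bigD1 i) //= addrCA lerDl addr_ge0 // sumr_ge0.
Qed.

Lemma dotDl (F : pzRingType) d (x y : 'rV[F]_d) (h : 'cV[F]_d) :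
  ((x + y) *m h) 0 0 = (x *m h) 0 0 + (y *m h) 0 0.
Proof. by rewrite mulmxDl mxE. Qed.

Lemma dotDr (F : pzRingType) d (x : 'rV[F]_d) (h h' : 'cV[F]_d) :
  (x *m (h + h')) 0 0 = (x *m h) 0 0 + (x *m h') 0 0.
Proof. by rewrite mulmxDr mxE. Qed.

Lemma dotZl (F : pzRingType) d c (x : 'rV[F]_d) (h : 'cV[F]_d) :
  (c *: x *m h) 0 0 = c * (x *m h) 0 0.
Proof. by rewrite -scalemxAl mxE. Qed.

Lemma dotZr (F : comPzRingType) d c (x : 'rV[F]_d) (h : 'cV[F]_d) :
  (x *m (c *: h)) 0 0 = c * (x *m h) 0 0.
Proof. by rewrite -scalemxAr mxE. Qed.

(** Gordan's alternative, by induction on the number of vectors: the functional [h] found for the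
    last [n] vectors is corrected according to its sign on the first vector [u]. *)
Lemma gordan (F : realFieldType) d n (v : 'I_n -> 'rV[F]_d) :
  (exists h : 'cV[F]_d, forall i, 0 < (v i *m h) 0 0) \/
  (exists c : 'I_n -> F, [/\ forall i, 0 <= c i, exists i, 0 < c i
     & \sum_i c i *: v i = 0]).
Proof.
elim: n v => [|n IH] v; first by left; exists 0; case.
pose w i := v (lift ord0 i); pose u := v ord0.
have [[h hP]|[c [c0 [i ci] cs]]] := IH w; last first.
  right; exists (fun j => if unlift ord0 j is Some j' then c j' else 0); split.
  - by move=> j; case: (unlift _ _).
  - by exists (lift ord0 i); rewrite liftK.
  - rewrite big_ord_recl unlift_none scale0r add0r -[RHS]cs.
    by apply: eq_bigr => j _; rewrite liftK.
have dec (h' : 'cV[F]_d) : 0 < (u *m h') 0 0 -> (forall i, 0 < (w i *m h') 0 0) ->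
    forall i, 0 < (v i *m h') 0 0.
  by move=> uh wh i; case: (unliftP ord0 i) => [j ->|->]; [exact: wh|exact: uh].
have [uh|uh|uh0] := ltgtP 0 ((u *m h) 0 0).
- by left; exists h; exact: dec.
(* Here [h] is negative on [u]. The vectors [w i + t i u] lie in the kernel of [h] and [t i > 0], so
   a nonnegative relation among them is one among the original vectors. *)
- pose t i := - (w i *m h) 0 0 / (u *m h) 0 0.
  have t0 i : 0 < t i by rewrite /t mulNr -mulrN -invrN divr_gt0 ?oppr_gt0 // hP.
  have [[h' h'P]|[c [c0 [i ci] cs]]] := IH (fun i => w i + t i *: u); last first.
    right; exists (fun j => if unlift ord0 j is Some j' then c j'
                            else \sum_i c i * t i); split.
    - move=> j; case: (unlift _ _) => //.
      by apply: sumr_ge0 => k _; rewrite mulr_ge0 // ltW.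
    - by exists (lift ord0 i); rewrite liftK.
    - rewrite big_ord_recl unlift_none -[RHS]cs scaler_suml -big_split.
      apply: eq_bigr => j _; rewrite liftK scalerDr scalerA addrC //.
  (* With this [r], [h' + r h] vanishes on [u] and takes at [w i] the positive value of [h'] at
     [w i + t i u]. Subtracting a small multiple of [h] makes it positive on [u] too. *)
  pose r := - (u *m h') 0 0 / (u *m h) 0 0.
  have h0P i : 0 < (w i *m (h' + r *: h)) 0 0.
    have swap (x y z : F) : - x / y * z = - z / y * x.
      by rewrite !mulNr mulrAC (mulrC x) mulrAC.
    by have := h'P i; rewrite dotDl dotDr dotZl dotZr /t /r swap.
  have [e e0 eP] := small_perturbation (fun i => - (w i *m h) 0 0) h0P.
  left; exists (h' + r *: h + (- e) *: h); apply: dec => [|i].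
    rewrite !dotDr !dotZr /r divfK ?lt_eqF // addrN add0r mulNr -mulrN.
    by rewrite mulr_gt0 // oppr_gt0.
  by have := eP i; rewrite [X in _ -> _ < X]dotDr dotZr mulrN mulNr.
(* Here [h] vanishes on [u]: either [u = 0] is itself a relation, or a small multiple of [u^T] is
   added to [h]. *)
- have [u0|un0] := eqVneq u 0.
    right; exists (fun j => if unlift ord0 j is Some _ then 0 else 1); split.
    + by move=> j; case: (unlift _ _).
    + by exists ord0; rewrite unlift_none.
    + rewrite big_ord_recl unlift_none -/u u0 scaler0 add0r big1 // => j _.
      by rewrite liftK scale0r.
  have uu0 : 0 < (u *m u^T) 0 0.
    have [j uj] : exists j, u 0 j != 0.
      apply/existsP; apply: contraNT un0 => /existsPn H.
      by apply/eqP/rowP => j; rewrite mxE; apply/eqP; rewrite -[_ == _]negbK H.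
    rewrite mxE (bigD1 j) //= ltr_pwDl //.
      by rewrite mxE -expr2 exprn_even_gt0.
    by apply: sumr_ge0 => l _; rewrite mxE -expr2 exprn_even_ge0.
  have [e e0 eP] := small_perturbation (fun i => (w i *m u^T) 0 0) hP.
  left; exists (h + e *: u^T); apply: dec => [|i].
    by rewrite dotDr dotZr -uh0 add0r mulr_gt0.
  by rewrite dotDr dotZr.
Qed.

Lemma common_denominator n (c : 'I_n -> rat) :
  exists2 D : nat, (0 < D)%N & exists z : 'I_n -> int,
    forall i, D%:R * c i = (z i)%:~R.
Proof.
pose D := (\prod_i `|denq (c i)|)%N.
exists D; first by rewrite prodn_gt0 // => i; rewrite absz_gt0 denq_eq0.
exists (fun i => numq (c i) * (\prod_(j | j != i) `|denq (c j)|)%N) => i.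
rewrite /D (bigD1 i) //= natrM intrM mulrAC; congr (_ * _).
by rewrite natr_absz normr_denq mulrC numqE.
Qed.

Section Faces.
Variables (q : nat) (M : affine_monoid q) (N : set 'rV[int]_q).
Hypotheses (NM : N `<=` am_set M) (Ndc : divisor_closed M N).

Let Nsub : submonoid N := Ndc.1.

Lemma divisor_closed_sum (s : seq 'rV[int]_q) (c : 'rV[int]_q -> nat) y :
  uniq s -> (forall z, z \in s -> am_set M z) -> N (\sum_(z <- s) z *+ c z) ->
  y \in s -> (0 < c y)%N -> N y.
Proof.
move=> us sM Ns ys cy0; have My := sM y ys.
apply: (Ndc.2 _ (y *+ (c y).-1 + \sum_(z <- s | z != y) z *+ c z) My).
  apply: amD; first exact: amMn.
  rewrite big_seq_cond; apply: submonoid_sum; first exact: submonoid_am.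
  by move=> z /andP[zs _]; apply: amMn; exact: sM.
by rewrite addrA -mulrS prednK // -(bigD1_seq y (r := s) (F := fun z => z *+ c z)).
Qed.

(** Gordan's theorem is applied to the generators outside N, modulo the span of those in N. Its
    first alternative gives the functional. Its second puts a nontrivial nonnegative combination of
    outside generators in that span, and divisor closure would then put one of them in N. *)
Lemma face_functional : exists h : 'cV[rat]_q,
  (forall x, am_set M x -> 0 <= (toQ x *m h) 0 0) /\
  (forall x, am_set M x -> ((toQ x *m h) 0 0 = 0 <-> N x)).
Proof.
have [s [us sM sgen]] := am_generators M.
pose sN := [seq y <- s | `[< N y >]]; pose s' := [seq y <- s | ~~ `[< N y >]].
pose B : 'M[rat]_(size sN, q) := \matrix_(i < size sN) toQ sN`_i.
(* Right multiplication by [K] is the projection modulo the row space of [B]. *)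
pose K := cokermx B.
have BK y : y \in s -> N y -> toQ y *m K = 0.
  move=> ys Ny; have yN : y \in sN by rewrite mem_filter asboolT.
  apply/eqP; rewrite -submxE; have iy : (index y sN < size sN)%N by rewrite index_mem.
  by have := row_sub (Ordinal iy) B; rewrite rowK nth_index.
have [[h hP]|[c [c0 [i0 ci0] cs]]] :=
    gordan (fun i : 'I_(size s') => toQ s'`_i *m K).
  have pos y : y \in s -> ~ N y -> 0 < (toQ y *m (K *m h)) 0 0.
    move=> ys Ny; have ys' : y \in s' by rewrite mem_filter asboolF.
    have iy : (index y s' < size s')%N by rewrite index_mem.
    have := hP (Ordinal iy); rewrite /= nth_index //.
    by rewrite -mulmxA.
  have zer y : y \in s -> N y -> (toQ y *m (K *m h)) 0 0 = 0.
    by move=> ys Ny; rewrite (mulmxA (toQ y)) BK // mul0mx mxE.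
  have exp (c : 'rV[int]_q -> nat) :
      (toQ (\sum_(y <- s) y *+ c y) *m (K *m h)) 0 0 =
      \sum_(y <- s) (toQ y *m (K *m h)) 0 0 *+ c y.
    rewrite toQ_sum mulmx_suml summxE; apply: eq_bigr => y _.
    by rewrite toQMn dotZl mulr_natl.
  have ge0 y : y \in s -> 0 <= (toQ y *m (K *m h)) 0 0.
    move=> ys; have [Ny|Ny] := pselect (N y); first by rewrite zer.
    exact/ltW/pos.
  exists (K *m h); split=> x Mx; have [c xc] := sgen x Mx; rewrite xc exp.
    by rewrite big_seq; apply: sumr_ge0 => y ys; rewrite mulrn_wge0 // ge0.
  split=> [/eqP|Nx].
    rewrite big_seq psumr_eq0 => [/allP H|y ys]; last by rewrite mulrn_wge0 // ge0.
    rewrite big_seq; apply: submonoid_sum => // y ys.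
    have [->|cy0] := posnP (c y); first by rewrite mulr0n; case: Nsub.
    apply: submonoidMn => //; have := H y ys; rewrite ys /= mulrn_eq0 eqn0Ngt cy0 /=.
    by apply: contraPP => /(pos y ys); rewrite lt0r => /andP[/negPf->].
  rewrite big_seq big1 // => y ys; have [->|cy0] := posnP (c y).
    by rewrite mulr0n.
  rewrite zer ?mul0rn //; apply: (@divisor_closed_sum s c y us _ Nx ys cy0).
    by move=> z /sM[].
exfalso.
have : ((\sum_i c i *: toQ s'`_i)%R <= B)%MS.
  by rewrite submxE mulmx_suml -[X in _ == X]cs; apply/eqP; apply: eq_bigr => i _; exact: (esym (scalemxAl _ _ _)).
move=> /submxP[d dE].
have [D D0 [z zP]] := common_denominator
  (fun i : 'I_(size s' + size sN) => match fintype.split i with inl j => c j | inr j => d 0 j end).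
pose z1 i := z (lshift _ i); pose z2 j := z (rshift _ j).
have z1P i : D%:R * c i = (z1 i)%:~R.
  by rewrite -zP -[lshift _ _]/(unsplit (inl i)) unsplitK.
have z2P j : D%:R * d 0 j = (z2 j)%:~R.
  by rewrite -zP -[rshift _ _]/(unsplit (inr j)) unsplitK.
have eqz : \sum_(i < size s') s'`_i *~ z1 i = \sum_(j < size sN) sN`_j *~ z2 j.
  apply: toQ_inj; rewrite !toQ_sum.
  transitivity (D%:R *: \sum_(i < size s') c i *: toQ s'`_i).
    rewrite scaler_sumr; apply: eq_bigr => i _.
    by rewrite scalerA z1P toQMz.
  rewrite dE mulmx_sum_row scaler_sumr; apply: eq_bigr => j _.
  by rewrite scalerA z2P toQMz rowK.
have z1ge0 i : 0 <= z1 i.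
  by rewrite -(ler0z rat) -z1P mulr_ge0 // ler0n.
have NsN j : (j < size sN)%N -> N sN`_j.
  by move=> /(mem_nth 0); rewrite mem_filter => /andP[/asboolP].
have Ms' j : (j < size s')%N -> am_set M s'`_j.
  by move=> /(mem_nth 0); rewrite mem_filter => /andP[_ /sM[]].
(* Moving the negative parts of the coefficients to the other side turns the relation into an
   equality between elements of M, one side of which lies in N. *)
pose zp j : nat := `|Num.max (z2 j) 0|%N; pose zn j : nat := `|Num.max (- z2 j) 0|%N.
have zpn j : z2 j = (zp j)%:Z - (zn j)%:Z by rewrite /zp /zn; lia.
have Npos : N (\sum_(j < size sN) sN`_j *+ zp j).
  by apply: submonoid_sum => // j _; apply: submonoidMn => //; exact: NsN.
have : N (\sum_(i < size s') s'`_i *+ `|z1 i|%N).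
  apply: (Ndc.2 _ (\sum_(j < size sN) sN`_j *+ zn j)).
  - apply: submonoid_sum; first exact: submonoid_am.
    by move=> i _; apply: amMn; exact: Ms'.
  - apply: submonoid_sum; first exact: submonoid_am.
    by move=> i _; apply: amMn; exact/NM/NsN.
  - suff -> : \sum_(i < size s') s'`_i *+ `|z1 i|%N + \sum_(j < size sN) sN`_j *+ zn j =
              \sum_(j < size sN) sN`_j *+ zp j by [].
    apply/eqP; rewrite eq_sym -subr_eq -sumrB; apply/eqP.
    transitivity (\sum_(j < size sN) sN`_j *~ z2 j).
      by apply: eq_bigr => j _; rewrite zpn mulrzBr -!pmulrn.
    by rewrite -eqz; apply: eq_bigr => i _; rewrite [RHS]pmulrn gez0_abs.
rewrite (bigD1 i0) //= => Ns.
have z10 : (0 < `|z1 i0|)%N.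
  by rewrite absz_gt0 -(intr_eq0 rat) -z1P mulf_neq0 ?pnatr_eq0 -?lt0n // gt_eqF.
have : N s'`_i0.
  apply: (Ndc.2 _ (s'`_i0 *+ `|z1 i0|.-1 + \sum_(i < size s' | i != i0) s'`_i *+ `|z1 i|%N)).
  - exact: Ms'.
  - apply: amD; first exact/amMn/Ms'.
    apply: submonoid_sum; first exact: submonoid_am.
    by move=> i _; apply: amMn; exact: Ms'.
  - by rewrite addrA -mulrS prednK.
have := mem_nth 0 (ltn_ord i0); rewrite mem_filter => /andP[/asboolPn H _].
exact: H.
Qed.

Lemma face_exists (R : realType) : exists F, face (cone R (am_set M)) F /\
  N = am_set M `&` [set x | F (toR R x)].
Proof.
have [h [h0 hN]] := face_functional.
pose hR : 'cV[R]_q := map_mx ratr h.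
have hE x : (toR R x *m hR) 0 0 = ratr ((toQ x *m h) 0 0).
  rewrite !mxE rmorph_sum; apply: eq_bigr => i _.
  by rewrite !mxE rmorphM /= ratr_int.
exists (cone R (am_set M) `&` [set x | (x *m hR) ord0 ord0 = 0]); split.
  exists hR; split=> // _ [n [c [v [c0 vM ->]]]].
  rewrite mulmx_suml summxE; apply: sumr_ge0 => i _.
  by rewrite -scalemxAl mxE mulr_ge0 // hE ler0q h0.
have inC x : am_set M x -> cone R (am_set M) (toR R x).
  move=> Mx; exists 1%N, (fun=> 1), (fun=> x); split=> //.
  by rewrite big_ord1 scale1r.
rewrite eqEsubset; split=> x; last first.
  by move=> [Mx [_ /eqP]]; rewrite /= hE fmorph_eq0 => /eqP /(hN x Mx).
move=> Nx; have Mx := NM Nx; split=> //; split; first exact: inC.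
by rewrite /= hE (hN x Mx).2 ?rmorph0.
Qed.

End Faces.

(** [pure_face] chooses some face with the required trace on M; the rank depends only on this trace,
    and [face_exists] shows that such a face exists. *)
Lemma mpdimE (R : realType) q (M : affine_monoid q) m : (1 < m)%N ->
  wset M m 0 -> mpdim R M = mrank (face_monoid M).
Proof.
move=> m1 W0; rewrite /mpdim /pure_face; case: xgetP => [F _ [_ FE]|/= noF].
  by rewrite -[X in mrank X]FE pure_primeE.
have [F FP] := face_exists (@face_monoid_am _ M) (divisor_closed_face m1 W0) R.
by case: (noF F); rewrite pure_primeE.
Qed.

(** * Counting lattice points *)

(** An independent family in N of maximal size spans, and its span has the universal property by
    which [Qspan] is chosen. *)
Lemma Qspan_basis q (N : set 'rV[int]_q) : exists Y : seq 'rV[int]_q,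
  [/\ forall y, y \in Y -> N y, free (map (@toQ q) Y),
      Qspan N = <<map (@toQ q) Y>>%VS
    & forall x, group_gen N x -> toQ x \in <<map (@toQ q) Y>>%VS].
Proof.
pose P n := `[< exists Y : seq 'rV[int]_q, [/\ forall y, y \in Y -> N y,
  free (map (@toQ q) Y) & size Y = n] >].
have P0 : exists n, P n.
  by exists 0%N; apply/asboolP; exists [::]; split=> //; exact: nil_free.
have Pb n : P n -> (n <= \dim {:'rV[rat]_q})%N.
  move=> /asboolP[Y [_ fY <-]]; rewrite -(size_map (@toQ q)).
  by move: fY; rewrite /free => /eqP <-; apply: dimvS; exact: subvf.
case: (ex_maxnP P0 Pb) => n /asboolP[Y [YN fY sY]] nmax.
have NU x : N x -> toQ x \in <<map (@toQ q) Y>>%VS.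
  move=> Nx; apply: contraT => xY.
  have /nmax : P n.+1; last by rewrite ltnn.
  apply/asboolP; exists (x :: Y); split=> [y|/=|/=]; last by rewrite sY.
    by rewrite inE => /predU1P[->|/YN].
  by rewrite free_cons xY.
pose U := <<map (@toQ q) Y>>%VS.
have GU x : group_gen N x -> toQ x \in U.
  apply: (@smallest_sub _ _ _ [set x | toQ x \in U]) => //; split=> /=.
    by rewrite /toQ raddf0 mem0v.
  by move=> a b aU bU; rewrite toQB rpredB.
have Umin (W : {vspace 'rV[rat]_q}) :
    (forall x, group_gen N x -> toQ x \in W) -> (U <= W)%VS.
  move=> HW; apply/span_subvP => _ /mapP[y /YN Ny ->].
  by apply: HW; exact: group_gen_sub.
exists Y; split=> //; rewrite /Qspan; case: xgetP => [V _ [GV Vmin]|/(_ U)[]//].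
by apply/eqP; rewrite eqEsubv Vmin // Umin.
Qed.

(** The rows of [G] form a basis of the rational span, and [c] picks columns with a nonzero minor.
    Cramer's rule recovers an element of ZN from its coordinates along [c]; cleared of denominators,
    it shows that the minor annihilates ZN modulo the rows of [G]. *)
Lemma frame q (N : set 'rV[int]_q) :
  exists (G : 'M[int]_(mrank N, q)) (c : 'I_(mrank N) -> 'I_q),
  [/\ forall i, N (row i G), \det (colsub c G) != 0
    & forall x, group_gen N x ->
        \det (colsub c G) *: x = colsub c x *m \adj (colsub c G) *m G].
Proof.
have [Y [YN fY QE spanY]] := Qspan_basis N.
have -> : mrank N = size Y.
  by rewrite /mrank QE; move: fY; rewrite /free size_map => /eqP.
pose Z := map_tuple (@toQ q) (in_tuple Y).
pose G : 'M[int]_(size Y, q) := \matrix_(i < size Y) Y`_i.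
pose GQ : 'M[rat]_(size Y, q) := map_mx intr G.
have rowGQ (i : 'I_(size Y)) : row i GQ = (map (@toQ q) Y)`_i.
  by rewrite -map_row rowK (nth_map 0).
have fG : row_free GQ.
  apply: inj_row_free => v vG.
  have /freeP/(_ (fun i => v 0 i)) H : free Z by [].
  apply/rowP => i; rewrite mxE; apply: H.
  rewrite -[RHS]vG mulmx_sum_row; apply: eq_bigr => j _.
  by rewrite rowGQ.
have fGT : row_full GQ^T by rewrite /row_full mxrank_tr; move: fG; rewrite /row_free.
pose c := fullrankfun fGT.
have detE : (\det (colsub c G))%:~R = \det (colsub c GQ) :> rat.
  by rewrite -det_map_mx /GQ; congr (\det _); apply/matrixP => i j; rewrite !mxE.
have unitc : colsub c GQ \in unitmx.
  rewrite -unitmx_tr; have := fullrowsub_unit fGT.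
  by congr (_ \in unitmx); apply/matrixP => i j; rewrite !mxE.
exists G, c; split=> [i||x Nx].
- by rewrite rowK; apply: YN; exact: mem_nth.
- by rewrite -(intr_eq0 rat) detE -unitfE -unitmxE.
have [u uE] : exists u : 'rV[rat]_(size Y), toQ x = u *m GQ.
  have xZ : toQ x \in <<Z>>%VS by exact: spanY.
  exists (\row_i coord Z i (toQ x)); rewrite [LHS](coord_span xZ) mulmx_sum_row.
  by apply: eq_bigr => j _; rewrite mxE rowGQ.
have cx : colsub c (toQ x) = u *m colsub c GQ.
  by rewrite uE; apply/matrixP => i j; rewrite !mxE; apply: eq_bigr => k _; rewrite !mxE.
apply: toQ_inj; rewrite /toQ map_mxZ !map_mxM map_mx_adj !map_mxsub.
rewrite -/(toQ x) -/GQ cx -(mulmxA u) mul_mx_adj mul_mx_scalar.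
by rewrite -scalemxAl -uE -detE.
Qed.

Lemma frame_inj q (N : set 'rV[int]_q) r (G : 'M[int]_(r, q)) (c : 'I_r -> 'I_q) :
  \det (colsub c G) != 0 ->
  (forall x, group_gen N x ->
     \det (colsub c G) *: x = colsub c x *m \adj (colsub c G) *m G) ->
  forall x, group_gen N x -> (forall j, x ord0 (c j) = 0) -> x = 0.
Proof.
move=> detA frameP x Nx xc; have := frameP x Nx.
have -> : colsub c x = 0 by apply/rowP => j; rewrite !mxE xc.
rewrite !mul0mx => /rowP dx; apply/rowP => i; have := dx i.
by rewrite !mxE => /eqP; rewrite mulf_eq0 (negPf detA) => /eqP.
Qed.

Lemma group_genD q (N : set 'rV[int]_q) x y :
  group_gen N x -> group_gen N y -> group_gen N (x + y).
Proof.
move=> Nx Ny; rewrite -[y]opprK -[- y]sub0r; apply: group_genB => //.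
by apply: group_genB => //; rewrite -(subrr y); exact: group_genB.
Qed.

Lemma group_genZ q (N : set 'rV[int]_q) (k : int) x :
  group_gen N x -> group_gen N (k *: x).
Proof.
move=> Nx; elim/int_rec: k => [|n IH|n IH].
- by rewrite scale0r -(subrr x); exact: group_genB.
- by rewrite intS scalerDl scale1r; exact: group_genD.
- by rewrite intS opprD scalerDl scaleN1r addrC; exact: group_genB.
Qed.

Lemma size_box (T : choiceType) (l : seq T) n B (f : T -> 'I_n -> nat) :
  uniq l -> {in l, forall a i, f a i < B}%N ->
  {in l &, forall a b, f a =1 f b -> a = b} -> (size l <= B ^ n)%N.
Proof.
move=> ul fB finj.
pose g (a : seq_sub l) : {ffun 'I_n -> 'I_B} :=
  [ffun i => Ordinal (fB _ (valP a) i)].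
have ginj : injective g.
  move=> a b /ffunP gab; apply/val_inj/finj; [exact: valP..|move=> i].
  by have := gab i; rewrite !ffunE => -[].
by have := leq_card g ginj; rewrite card_seq_sub // card_ffun !card_ord.
Qed.

Section Counting.
Variables (q : nat) (M : affine_monoid q).
Let N := face_monoid M.
Let s := mrank N.
Variables (G : 'M[int]_(s, q)) (c : 'I_s -> 'I_q).
Let A := colsub c G.
Hypotheses (GN : forall i, N (row i G)) (detA : \det A != 0).
Hypothesis frameP : forall x, group_gen N x ->
  \det A *: x = colsub c x *m \adj A *m G.

Let g : 'rV[int]_q := \sum_i row i G.

Let wsetN m : (1 < m)%N -> wset M m `<=` N.
Proof. by move=> m1 a Wa; exists m. Qed.

Let frame_inj := frame_inj detA frameP.

Let wset_diff m a b : (1 < m)%N -> wset M m a -> wset M m b -> group_gen N (a - b).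
Proof.
move=> m1 Wa Wb; apply: group_genB; apply: group_gen_sub.
  exact: wsetN Wa.
exact: wsetN Wb.
Qed.

(** Elements of W_m differ by elements of ZN, so their [s] coordinates along [c] separate them; each
    coordinate is at most a constant times [m]. *)
Lemma wset_size_bound : exists K : nat, forall m, (1 < m)%N ->
  (size (wseq M m) <= (K * m) ^ s)%N.
Proof.
have [K KP] := wset_bound M; exists K.+1 => m m1.
apply: (@size_box 'rV[int]_q (wseq M m) s (K.+1 * m) (fun a j => `|a ord0 (c j)|%N)).
- exact: wseq_uniq.
- move=> a /wseqP Wa j; have := KP m a Wa (c j); have := am_ge0 Wa.1 (c j).
  rewrite mulSn; move: (K * m)%N (a ord0 (c j)) => ? ?; lia.
- move=> a b /wseqP Wa /wseqP Wb ab; apply/eqP; rewrite -subr_eq0; apply/eqP.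
  apply: frame_inj; first exact: wset_diff Wa Wb.
  move=> j; rewrite !mxE; have := ab j => /=.
  have := am_ge0 Wa.1 (c j); have := am_ge0 Wb.1 (c j).
  lia.
Qed.

(** W_m is split by whether [g] can be subtracted within M: the first part is tiled into W_n, the
    second is of lower order. *)
Definition wgood m := [seq b <- wseq M m | `[< am_set M (b - g) >]].
Definition wbad m := [seq b <- wseq M m | ~~ `[< am_set M (b - g) >]].

Lemma size_wgood_wbad m : (size (wgood m) + size (wbad m))%N = size (wseq M m).
Proof. by rewrite !size_filter count_predC. Qed.

Hypothesis Ndc : divisor_closed M N.

Let gN : N g. Proof. by apply: submonoid_sum => // ; exact: Ndc.1. Qed.
Let gM : am_set M g. Proof. exact: face_monoid_am gN. Qed.

(* The elements of [wbad m] lie in pairwise distinct classes modulo [g], and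
   the quotient of the group by [g] has rank [s - 1]. *)
Lemma wbad_size_bound : exists K : nat, forall m, (1 < m)%N ->
  (m * size (wbad m) <= (K * m) ^ s)%N.
Proof.
(* If all chosen coordinates of [g] vanish, then [g = 0] and no element is bad. *)
case: (pickP (fun j => g ord0 (c j) != 0)) => [j0 gj0|g0]; last first.
  exists 0%N => m m1; suff -> : wbad m = [::] by rewrite muln0.
  apply/eqP; rewrite -[_ == _]negbK -has_filter; apply/hasPn => b /wseqP Wb.
  rewrite negbK; apply/asboolP; suff -> : g = 0 by rewrite subr0; exact: Wb.1.
  by apply: frame_inj => [|j]; [exact: group_gen_sub|exact/eqP/negbFE/g0].
pose d := `|g ord0 (c j0)|%N.
have d0 : (0 < d)%N by rewrite absz_gt0.
have dE : g ord0 (c j0) = d%:Z by rewrite gez0_abs //; exact: am_ge0 gM _.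
have [K KP] := wset_bound M.
pose S := (\sum_j `|g ord0 (c j)|)%N.
have gS j : g ord0 (c j) <= S%:Z.
  by have := am_ge0 gM (c j); rewrite /S (bigD1 j) //=; lia.
exists (S * K + d * K + d + 1)%N => m m1.
(* Pairing each bad element with every [t < m] reduces the bound to an injection into a box with [s]
   sides. *)
have -> : (m * size (wbad m))%N = size [seq (b, t) | b <- wbad m, t <- iota 0 m].
  by rewrite size_allpairs size_iota mulnC.
(* The number [d b_i - g_i b_j0] does not change when [g] is added to [b]; the shift by [S K m]
   makes it nonnegative. The slot [j0], where it would vanish, stores [b_j0] modulo [d] together
   with [t]. *)
pose f (bt : 'rV[int]_q * nat) (i : 'I_s) : nat :=
  if i == j0 then (`|bt.1 ord0 (c j0)| %% d * m + bt.2)%N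
  else `|(d%:Z * bt.1 ord0 (c i) - g ord0 (c i) * bt.1 ord0 (c j0) + (S * K * m)%N%:Z)%R|%N.
have badP b t : (b, t) \in [seq (b, t) | b <- wbad m, t <- iota 0 m] ->
    [/\ wset M m b, ~ am_set M (b - g) & (t < m)%N].
  move=> /allpairsP[[b' t'] /= [+ + [-> ->]]].
  rewrite mem_filter mem_iota add0n /= => /andP[/asboolPn bg /wseqP Wb] tm.
  by split.
have fge b i : wset M m b -> 0 <= d%:Z * b ord0 (c i) - g ord0 (c i) * b ord0 (c j0) + (S * K * m)%N%:Z.
  move=> Wb; have b0 := am_ge0 Wb.1; have bK := KP m b Wb.
  have g0 := am_ge0 gM (c i).
  have := b0 (c i); have := b0 (c j0); have := bK (c j0); have := gS i.
  move: (b ord0 (c i)) (b ord0 (c j0)) (g ord0 (c i)) g0 => x y z z0 zS yK y0 x0.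
  have : z * y <= S%:Z * (K * m)%:Z by apply: ler_pM.
  have : 0 <= d%:Z * x by apply: mulr_ge0.
  by rewrite -mulnA PoszM; lia.
apply: (@size_box _ _ _ _ f).
- apply: allpairs_uniq; [exact/filter_uniq/wseq_uniq|exact: iota_uniq|].
  by move=> [? ?] [? ?] /= _ _ [-> ->].
- move=> [b t] /badP[Wb _ tm] i; rewrite /f; case: eqP => [_|_] /=.
    have := ltn_pmod `|b ord0 (c j0)| d0.
    by move: (_ %% _)%N => r rd; nia.
  have := fge b i Wb; have b0 := am_ge0 Wb.1; have bK := KP m b Wb.
  have := bK (c i); have := b0 (c i); have := b0 (c j0); have := am_ge0 gM (c i).
  move: (b ord0 (c i)) (b ord0 (c j0)) (g ord0 (c i)) => x y z z0 y0 x0 xK H.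
  have : 0 <= z * y by apply: mulr_ge0.
  have : d%:Z * x <= d%:Z * (K * m)%:Z by apply: ler_wpM2l.
  move: H; rewrite -PoszM; move: (z * y) => zy.
  move: (d%:Z * x) => dx; nia.
- move=> [b t] [b' t'] /badP[Wb bg tm] /badP[Wb' b'g tm'] ff.
  have Nbb' : group_gen N (b - b') by exact: wset_diff Wb Wb'.
  have [rr tt'] : (`|b ord0 (c j0)| %% d = `|b' ord0 (c j0)| %% d)%N /\ t = t'.
    have := ff j0; rewrite /f eqxx /= => E; split.
      by have := congr1 (divn^~ m) E; rewrite !divnMDl ?(ltnW m1) // !divn_small // !addn0.
    by have := congr1 (modn^~ m) E; rewrite !modnMDl !modn_small.
  rewrite -{}tt' in ff *; congr (_, _).
  (* Equal invariants make [b - b'] proportional to [g]; equal residues then make the factor an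
     integer. *)
  have crs i : d%:Z * (b - b') ord0 (c i) = g ord0 (c i) * (b - b') ord0 (c j0).
    rewrite !mxE; have [->|ij] := eqVneq i j0; first by rewrite dE.
    have := ff i; rewrite /f (negPf ij) /= => E.
    have := fge b i Wb; have := fge b' i Wb'; move: E.
    set X := (X in `|X|%N = _ -> _); set Y := (X in _ = `|X|%N -> _) => E Y0 X0.
    have : X = Y by lia.
    by rewrite /X /Y; lia.
  have [k kE] : exists k : int, (b - b') ord0 (c j0) = k * d%:Z.
    apply/dvdzP; rewrite !mxE -eqz_mod_dvd.
    have := rr; rewrite -(gez0_abs (am_ge0 Wb.1 _)) -(gez0_abs (am_ge0 Wb'.1 _)).
    by rewrite !modz_nat => ->.
  have bE : b - b' = k *: g.
    apply/eqP; rewrite -subr_eq0; apply/eqP; apply: frame_inj.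
      apply: group_genB => //; apply: group_genZ; exact: group_gen_sub.
    move=> j; rewrite mxE [(- (k *: g)) _ _]mxE [(k *: g) _ _]mxE.
    apply: (@mulfI _ d%:Z); first by rewrite eqz_nat -lt0n.
    by rewrite mulr0 mulrBr crs kE; ring.
  (* If [x = y + z g] with [z > 0], then [x - g] lies in M, so [x] is not bad; used in both
     directions, this forces [k = 0]. *)
  have le0 (x y : 'rV[int]_q) (z : int) : am_set M y -> ~ am_set M (x - g) -> x - y = z *: g -> z <= 0.
    move=> My xg xy; rewrite leNgt; apply/negP => z0; apply: xg.
    have -> : x - g = y + (z - 1) *: g.
      by rewrite scalerBl -xy scale1r addrA [y + _]addrC subrK.
    apply: amD => //; rewrite -(gez0_abs (_ : 0 <= z - 1)); last by lia.
    by rewrite -[X in X *: _]natz scaler_nat; exact: amMn.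
  have k0 : k = 0.
    have := le0 _ _ _ Wb'.1 bg bE.
    have : b' - b = (- k) *: g by rewrite scaleNr -bE opprB.
    move=> /(le0 _ _ _ Wb.1 b'g); lia.
  by apply/eqP; rewrite -subr_eq0 bE k0 scale0r.
Qed.

(** Equal images give [k (b - b') = z G] with the entries of [z] below [k] in absolute value. As [k]
    divides [\det A z] and is prime to [\det A], it divides [z], so [z = 0]. *)
Lemma wset_tiling m n k : (1 < m)%N -> (0 < k)%N -> coprime k `|\det A| ->
  wset M n 0 -> (k * m <= n)%N ->
  (k ^ s * size (wgood m) <= size (wseq M n))%N.
Proof.
move=> m1 k0 cop Wn kmn.
pose Y (y : {ffun 'I_s -> 'I_k}) : 'rV[int]_q := \sum_i row i G *+ y i.
pose h b y := b *+ k - Y y.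
have YM y : am_set M (Y y).
  apply: submonoid_sum; first exact: submonoid_am.
  by move=> i _; apply/amMn/face_monoid_am/GN.
have -> : (k ^ s * size (wgood m))%N =
    size [seq h b y | b <- wgood m, y <- enum {ffun 'I_s -> 'I_k}].
  by rewrite size_allpairs mulnC -cardE card_ffun !card_ord.
apply: uniq_leq_size.
  apply: allpairs_uniq; [exact/filter_uniq/wseq_uniq|exact: enum_uniq|].
  have wN b y : (b, y) \in [seq (b, y) | b <- wgood m, y <- enum {ffun 'I_s -> 'I_k}] ->
      wset M m b.
    move=> /allpairsP[[b' y'] /= [+ _ [-> _]]].
    by rewrite mem_filter => /andP[_ /wseqP].
  move=> [b y] [b' y'] /wN Wb /wN Wb' /=; rewrite /h => E.
  pose z : 'rV[int]_s := \row_i ((y i)%:Z - (y' i)%:Z).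
  have Dgen := wset_diff m1 Wb Wb'.
  have [u uE] : exists u, u = colsub c (b - b') *m \adj A by eexists.
  have zG : z *m G = (b - b') *+ k.
    transitivity (Y y - Y y'); last first.
      rewrite mulrnBl -(subrK (Y y) (b *+ k)) E [RHS]addrAC.
      by rewrite (addrAC (b' *+ k)) subrr add0r addrC.
    rewrite mulmx_sum_row /Y -sumrB; apply: eq_bigr => i _.
    by rewrite mxE scalerBl -!scaler_nat !natz.
  have inj (x : 'rV[int]_s) : x *m G = 0 -> x = 0.
    move=> xG; have : x *m A *m \adj A = 0.
      suff -> : x *m A = 0 by rewrite mul0mx.
      apply/rowP => j; have /rowP/(_ (c j)) := xG; rewrite !mxE => H.
      by rewrite -[RHS]H; apply: eq_bigr => l _; rewrite !mxE.
    rewrite -mulmxA mul_mx_adj mul_mx_scalar => /rowP dx; apply/rowP => i.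
    by have := dx i; rewrite !mxE => /eqP; rewrite mulf_eq0 (negPf detA) => /eqP.
  have zu i : \det A * z 0 i = u 0 i * k%:Z.
    have : \det A *: z - k%:Z *: u = 0.
      apply: inj; rewrite mulmxBl -!scalemxAl zG uE -(frameP Dgen).
      by rewrite -scaler_nat scalerA scalerA natz mulrC subrr.
    by move=> /rowP/(_ i); rewrite !mxE => /eqP; rewrite subr_eq0 mulrC [_ * u _ _]mulrC => /eqP.
  have yy' : y = y'.
    apply/ffunP => i; apply: val_inj => /=.
    have : (k %| z 0%R i)%Z.
      rewrite -(@Gauss_dvdzr _ (\det A)); last by rewrite coprimezE.
      by rewrite zu dvdz_mull.
    rewrite mxE; have := ltn_ord (y i); have := ltn_ord (y' i).
    move: (nat_of_ord (y i)) (nat_of_ord (y' i)) => v w wk vk.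
    rewrite dvdzE /=; have [v0|v0] := posnP `|v%:Z - w%:Z|%N; first by lia.
    by move=> /(dvdn_leq v0); lia.
  rewrite yy' in E *; congr (_, _).
  move: E => /addIr /eqP; rewrite -subr_eq0 -mulrnBl => /eqP/rowP bk.
  apply/rowP => i; apply/eqP; rewrite -subr_eq0; have := bk i.
  by rewrite mulmxnE !mxE => /eqP; rewrite mulrn_eq0 eqn0Ngt k0.
move=> _ /allpairsP[[b y] [+ _ ->]] /=; rewrite mem_filter => /andP[/asboolP Mbg /wseqP Wb].
apply/wseqP; apply: (@wset_dvd _ _ _ _ (Y y)) => //.
  (* The image is [k (b - g)] plus a nonnegative combination of the rows of [G], hence lies in M; it
     is a divisor of [k b], which is in W_n. *)
  rewrite /h /Y (_ : b *+ k - _ = (b - g) *+ k + \sum_i row i G *+ (k - y i)).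
    apply: amD; first exact: amMn.
    apply: submonoid_sum; first exact: submonoid_am.
    by move=> i _; apply/amMn/face_monoid_am/GN.
  rewrite mulrnBl -addrA; congr (_ + _); rewrite /g -sumrMnl -!sumrN -big_split.
  by apply: eq_bigr => i _ /=; rewrite mulrnBr ?(ltnW (ltn_ord _)) // addrA addNr add0r.
by rewrite /h subrK; apply: wset_scale Wb kmn.
Qed.

End Counting.

(** * Convergence of the ratios [|W_m| / m^s] *)

Lemma coprime_quotient m n d : (0 < m)%N -> (0 < d)%N -> (m <= n)%N ->
  exists k, [/\ (0 < k)%N, coprime k d, (k * m <= n)%N & (n <= k * m + d * m)%N].
Proof.
(* The witness [j d + 1] is the largest integer congruent to 1 modulo [d] not exceeding [t], so
   [t + 1] is at most [k + d]. *)
move=> m0 d0 mn; pose t := (n %/ m)%N; pose j := ((t - 1) %/ d)%N.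
have t1 : (0 < t)%N by rewrite divn_gt0.
have jd : (j * d <= t - 1)%N by exact: leq_trunc_div.
have jd' : (t - 1 < j.+1 * d)%N by rewrite -ltn_divLR.
have tm : (t * m <= n)%N by exact: leq_trunc_div.
have tm' : (n < t.+1 * m)%N by rewrite -ltn_divLR.
exists (j * d + 1)%N; split.
- by rewrite addn1.
- by rewrite coprime_sym /coprime gcdnMDl gcdn1.
- by apply: leq_trans tm; rewrite leq_mul2r; apply/orP; right; lia.
- rewrite -mulnDl; apply/ltnW/(leq_trans tm'); rewrite leq_mul2r; apply/orP; right.
  by rewrite mulSn in jd'; lia.
Qed.

(** Each further factor [x] loses [x^s (1 - x)], which is at most [u]. *)
Lemma expr_bernoulli (R : realFieldType) (x u : R) s : 0 <= x <= 1 ->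
  1 - u <= x -> 1 - s%:R * u <= x ^+ s.
Proof.
move=> /andP[x0 x1] ux; elim: s => [|s IH]; first by rewrite mul0r subr0 expr0.
have xs0 : 0 <= x ^+ s by exact: exprn_ge0.
have xs1 : x ^+ s <= 1 by exact: exprn_ile1.
have : x ^+ s * (1 - x) <= 1 - x by apply: ler_piMl => //; rewrite subr_ge0.
by rewrite exprSr -natr1; lra.
Qed.

(** Here [al] and [be] are the good and bad parts of the ratio at [m], [fn] is the ratio at [n], and
    [y] is [(k m / n)^s], which is at least [1 - c]. *)
Lemma combine_estimates (R : realFieldType) (al be fn K C y c : R) :
  al * y <= fn -> be <= K -> al * (1 - c) <= al * y -> al * c <= C ->
  al + be <= fn + K + C.
Proof. by rewrite mulrBr mulr1; lra. Qed.

(** The limit is the supremum of [w m - K / m]: it bounds [w n] from above up to [K / n], and an [m]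
    that almost attains it bounds [w n] from below up to [C m / n]. *)
Lemma almost_monotone_cvg (R : realType) (A : nat -> Prop) (w : nat -> R) B K C :
  0 <= K -> 0 <= C -> (exists m, A m) ->
  (forall m, A m -> (0 < m)%N /\ w m <= B) ->
  (forall m n, A m -> A n -> (m <= n)%N -> w m <= w n + K / m%:R + C * (m%:R / n%:R)) ->
  exists l, forall e, 0 < e -> exists n0, forall n, (n0 <= n)%N -> A n ->
    `|w n - l| < e.
Proof.
move=> K0 C0 [m0 Am0] wB wmono.
pose E := [set w m - K / m%:R | m in A].
have supE : has_sup E.
  split; first by exists (w m0 - K / m0%:R), m0.
  exists B => _ [m Am <-]; have [m_gt0 wmB] := wB m Am.
  have : 0 <= K / m%:R by rewrite divr_ge0.
  by lra.
exists (sup E) => e e0.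
have e20 : 0 < e / 2 by lra.
have [_ [m Am <-] mE] := sup_adherent e20 supE.
have [m_gt0 _] := wB m Am.
pose n0 := maxn m (Num.bound (2 * (K + C * m%:R) / e)).+1.
exists n0 => n; rewrite geq_max => /andP[mn bn] An.
have n_gt0 : 0 < n%:R :> R by rewrite ltr0n (leq_trans m_gt0).
have small : K + C * m%:R < e / 2 * n%:R.
  have : 2 * (K + C * m%:R) / e < n%:R.
    apply: (@lt_trans _ _ (Num.bound (2 * (K + C * m%:R) / e))%:R); last by rewrite ltr_nat.
    by apply: archi_boundP; rewrite divr_ge0 ?(ltW e0) // mulr_ge0 // addr_ge0 // mulr_ge0.
  rewrite ltr_pdivrMr // => H; lra.
have Cm0 : 0 <= C * m%:R by apply: mulr_ge0.
have Kn : K / n%:R < e / 2 by rewrite ltr_pdivrMr //; lra.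
have Cn : C * (m%:R / n%:R) < e / 2 by rewrite mulrA ltr_pdivrMr //; lra.
have up : w n - K / n%:R <= sup E by apply: sup_upper_bound => //; exists n.
have := wmono m n Am An mn.
by rewrite ltr_norml; lra.
Qed.

Section Ratio.
Variables (R : realType) (q : nat) (M : affine_monoid q) (p : nat).
Hypotheses (p1 : (1 < p)%N) (Wp : wset M p 0).
Let s := mrank (face_monoid M).

Definition face_ratio m : R := (size (wseq M m))%:R / m%:R ^+ s.

Lemma face_ratio_bound : exists2 B : R, 0 <= B &
  forall m, (1 < m)%N -> face_ratio m <= B.
Proof.
have [G [c [GN detA frameP]]] := frame (face_monoid M).
have [K KP] := wset_size_bound detA frameP.
exists (K ^ s)%:R; first exact: ler0n.
move=> m m1; rewrite /face_ratio ler_pdivrMr ?exprn_gt0 ?ltr0n ?(ltnW m1) //.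
by rewrite -natrX -natrM ler_nat -expnMn; exact: KP.
Qed.

Lemma face_ratio_mono : exists K C : R, [/\ 0 <= K, 0 <= C &
  forall m n, (1 < m)%N -> wset M n 0 -> (m <= n)%N ->
    face_ratio m <= face_ratio n + K / m%:R + C * (m%:R / n%:R)].
Proof.
have Ndc := divisor_closed_face p1 Wp.
have [G [c [GN detA frameP]]] := frame (face_monoid M).
have [K1 K1P] := wset_size_bound detA frameP.
have [K2 K2P] := wbad_size_bound GN detA frameP Ndc.
have til := wset_tiling GN detA frameP.
set d := `|\det (colsub c G)|%N in til.
have d0 : (0 < d)%N by rewrite absz_gt0.
exists (K2 ^ s)%:R, ((K1 ^ s)%:R * (s%:R * d%:R)); split; first exact: ler0n.
  by rewrite !mulr_ge0 ?ler0n.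
move=> m n m1 Wn mn; have m0 : (0 < m)%N := ltnW m1.
have n0 : (0 < n)%N := leq_trans m0 mn.
have mR : 0 < m%:R :> R by rewrite ltr0n.
have nR : 0 < n%:R :> R by rewrite ltr0n.
have msR : 0 < m%:R ^+ s :> R by rewrite exprn_gt0.
have nsR : 0 < n%:R ^+ s :> R by rewrite exprn_gt0.
have [k [k0 kd km kn]] := coprime_quotient m0 d0 mn.
have {til} til := til m n k m1 k0 kd Wn km.
have sz := size_wgood_wbad G m.
have bad := K2P m m1; have tot := K1P m m1.
move: (size (wgood G m)) (size (wbad G m)) sz til bad => a b sz til bad.
have aK : a%:R / m%:R ^+ s <= (K1 ^ s)%:R :> R.
  rewrite ler_pdivrMr // -natrX -natrM ler_nat -expnMn; apply: leq_trans tot.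
  by rewrite -sz leq_addr.
have bK : b%:R / m%:R ^+ s <= (K2 ^ s)%:R / m%:R :> R.
  rewrite ler_pdivrMr // mulrAC ler_pdivlMr // -natrX -!natrM ler_nat -expnMn.
  by rewrite mulnC.
have wm : face_ratio m = a%:R / m%:R ^+ s + b%:R / m%:R ^+ s.
  by rewrite /face_ratio -sz natrD mulrDl.
(* Tiling bounds the good part times [x^s] by the ratio at [n], and the choice of [k] gives
   [x >= 1 - d m / n]. *)
pose x : R := k%:R * m%:R / n%:R.
have x01 : 0 <= x <= 1.
  by rewrite /x divr_ge0 ?mulr_ge0 ?ler0n //= ler_pdivrMr // mul1r -natrM ler_nat.
have xu : 1 - d%:R * (m%:R / n%:R) <= x.
  rewrite /x ler_pdivlMr // mulrBl mul1r mulrA divfK ?gt_eqF //.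
  by rewrite lerBlDr -!natrM -natrD ler_nat.
have axs : a%:R / m%:R ^+ s * x ^+ s <= face_ratio n.
  rewrite /x expr_div_n exprMn /face_ratio.
  rewrite (_ : _ * _ = (k ^ s * a)%:R / n%:R ^+ s); last first.
    rewrite natrM natrX mulrA; congr (_ / _).
    by rewrite mulrACA mulVf ?mulr1 1?mulrC // gt_eqF.
  by rewrite ler_pM2r ?invr_gt0 // ler_nat.
have := expr_bernoulli s x01 xu.
have mu0 : 0 <= m%:R / n%:R :> R by rewrite divr_ge0 ?ler0n.
have a0 : 0 <= a%:R / m%:R ^+ s :> R by rewrite divr_ge0 ?ler0n // ltW.
have c0 : 0 <= s%:R * (d%:R * (m%:R / n%:R)) :> R by rewrite !mulr_ge0 ?ler0n.
move=> yb; have H1 := ler_wpM2l a0 yb; have H2 := ler_wpM2r c0 aK.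
rewrite wm -mulrA -[s%:R * d%:R * _]mulrA.
exact: combine_estimates axs bK H1 H2.
Qed.

Lemma face_ratio_cvg : exists l : R, forall e, 0 < e ->
  exists n0, forall n, (n0 <= n)%N -> (1 < n)%N -> wset M n 0 ->
    `|face_ratio n - l| < e.
Proof.
have [B _ wB] := face_ratio_bound; have [K [C [K0 C0 mono]]] := face_ratio_mono.
pose A n := (1 < n)%N /\ wset M n 0.
have [l lP] : exists l, forall e, 0 < e -> exists n0, forall n, (n0 <= n)%N -> A n ->
    `|face_ratio n - l| < e.
  apply: (@almost_monotone_cvg _ _ _ B K C) => //; first by exists p.
    by move=> m [m1 _]; split; [exact: ltnW|exact: wB].
  by move=> m n [m1 _] [_ Wn] mn; exact: mono.
exists l => e /lP[n0 n0P]; exists n0 => n nn n1 Wn; exact: n0P.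
Qed.

End Ratio.

(** The number [cnt m] of elements of [B] below [m] increases by one exactly after an element of
    [B], so an unbounded [B] has an element with [t] predecessors; it is at least [t] because
    [cnt m <= m]. *)
Lemma nth_eltP (B : set nat) t : (forall n, exists2 m, (n <= m)%N & B m) ->
  B (nth_elt B t) /\ (t <= nth_elt B t)%N.
Proof.
move=> Binf; pose cnt m := (\sum_(i < m) `[< B i >])%N.
have cntE m : #|[set i : 'I_m | `[< B i >]]%SET| = cnt m.
  by rewrite cardsE -sum1_card big_mkcond /=; apply: eq_bigr => i _; rewrite unfold_in; case: `[< _ >].
have cntS m : cnt m.+1 = (cnt m + `[< B m >])%N by rewrite /cnt big_ord_recr.
have cnt_le m : (cnt m <= m)%N.
  elim: m => [|m IH]; first by rewrite /cnt big_ord0.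
  by rewrite cntS -addn1 leq_add // leq_b1.
have cnt_mono m n : (m <= n)%N -> (cnt m <= cnt n)%N.
  elim: n => [|n IH]; first by rewrite leqn0 => /eqP->.
  rewrite leq_eqVlt => /predU1P[->//|mn]; apply: (leq_trans (IH mn)).
  by rewrite cntS leq_addr.
have cnt_unbounded u : exists m, (u <= cnt m)%N.
  elim: u => [|u [m um]]; first by exists 0%N.
  have [m' mm' Bm'] := Binf m; exists m'.+1.
  by rewrite cntS asboolT // addn1 ltnS (leq_trans um) // cnt_mono.
have [m [Bm cm]] : exists m, B m /\ cnt m = t.
  have ex : exists m, (t < cnt m.+1)%N.
    have [[|m] tm] := cnt_unbounded t.+1; last by exists m.
    by move: tm; rewrite /cnt big_ord0.
  case: (ex_minnP ex) => m tm mmin.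
  have cmt : (cnt m <= t)%N.
    case: m {tm} mmin => [|m] mmin; first by rewrite /cnt big_ord0.
    by rewrite leqNgt; apply/negP => /mmin; rewrite ltnn.
  exists m; move: tm; rewrite cntS; case: asboolP => Bm tm; split=> //; lia.
rewrite /nth_elt; case: xgetP => [n _ [Bn nt]|/(_ m)[]].
  by split=> //; rewrite -nt cntE; exact: cnt_le.
by split=> //; rewrite cntE.
Qed.

(** * The ideals [I_e] *)

Section SemigroupRing.
Variables (k : fieldType) (q : nat) (M : affine_monoid q).
Local Notation SR := (sgring k M).
Implicit Types (a b d : expo M) (f g : SR) (v w : 'rV[int]_q) (c : k).

(* Locked, as unification would otherwise unfold products of monomials. *)
Fact mono_key : unit. Proof. exact: tt. Qed.
Definition mono a c : SR := locked_with mono_key (fun a c => mkmalgU a c : SR) a c.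

Lemma monoE a c : mono a c = mkmalgU a c.
Proof. by rewrite /mono unlock. Qed.

(* The coefficient of [x^v], extended by [0] to all vectors [v]. *)
Definition cf v f : k := if insub v is Some a then mcoeff (a : expo M) f else 0.

Lemma mcoeffE_cf a f : mcoeff a f = cf (expo_val a) f.
Proof. by rewrite /cf valK. Qed.

Lemma cf_out v f : ~ am_set M v -> cf v f = 0.
Proof. by move=> Mv; rewrite /cf insubF //; apply/negP => /asboolP. Qed.

Lemma cf_neq0 v f : cf v f != 0 -> am_set M v.
Proof. by move=> fv; apply: contrapT => Mv; move: fv; rewrite cf_out ?eqxx. Qed.

Lemma cfD v : {morph cf v : f g / f + g}.
Proof. by move=> f g; rewrite /cf; case: insub => [a|]; rewrite ?addr0 // mcoeffD. Qed.

Lemma cf0 v : cf v 0 = 0.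
Proof. by rewrite /cf; case: insub => // a; rewrite mcoeff0. Qed.

Lemma cfZ v c f : cf v (c *: f) = c * cf v f.
Proof. by rewrite /cf; case: insub => [a|]; rewrite ?mulr0 // mcoeffZ. Qed.

Lemma cf_sum v (I : Type) (r : seq I) (P : pred I) (F : I -> SR) :
  cf v (\sum_(i <- r | P i) F i) = \sum_(i <- r | P i) cf v (F i).
Proof. by rewrite (big_morph (cf v) (cfD v) (cf0 v)). Qed.

Lemma cfP f g : (forall v, cf v f = cf v g) <-> f = g.
Proof.
split=> [fg|-> //]; apply/malgP => a.
by rewrite !mcoeffE_cf.
Qed.

Lemma cf_mono v a c : cf v (mono a c) = if expo_val a == v then c else 0.
Proof.
rewrite /cf monoE; case: insubP => [b _ bv|nv].
  by rewrite mcoeffU -bv (inj_eq val_inj); case: eqP; rewrite ?mulr1n ?mulr0n.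
case: eqP => // av; rewrite -av in nv.
by case/negP: nv; exact/asboolP/expoP.
Qed.

Lemma mono_expand f : f = \sum_(a <- msupp f) mono a (mcoeff a f).
Proof. by rewrite {1}[f]monalgE; apply: eq_bigr => a _; rewrite monoE. Qed.

Lemma monoM a b c c' : mono a c * mono b c' = mono (mul a b) (c * c').
Proof. by rewrite !monoE; exact: fgmulUU. Qed.

Lemma monoX a c n : exists2 b, expo_val b = expo_val a *+ n & mono a c ^+ n = mono b (c ^+ n).
Proof.
elim: n => [|n [b bn IH]].
  by exists (expo0 M); rewrite //= !expr0 monoE.
by exists (mul a b); rewrite ?exprS ?IH ?monoM //= bn mulrS.
Qed.

(** The extension of [cf] by zero covers the vectors [v] from which [a] cannot be subtracted within
    M. *)
Lemma cf_monoM v a c f : cf v (mono a c * f) = c * cf (v - expo_val a) f.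
Proof.
rewrite {1}(mono_expand f) mulr_sumr cf_sum [in RHS](mono_expand f) cf_sum mulr_sumr.
apply: eq_bigr => b _; rewrite monoM !cf_mono /= addrC.
have -> : (expo_val b == v - expo_val a) = (expo_val b + expo_val a == v).
  by rewrite eq_sym subr_eq eq_sym.
by case: (_ == v); rewrite ?mulr0.
Qed.

(** The constant coefficient is a ring morphism, as 0 is the only unit of M; conversely, an element
    without constant term is a combination of the generating monomials. *)
Lemma hmaxP f : @hmax k q M f <-> cf 0 f = 0.
Proof.
have c0 g : cf 0 g = mcoeff (monalg.one : expo M) g by rewrite mcoeffE_cf.
split.
  apply: (@smallest_sub _ _ _ [set f | cf 0 f = 0]).
    split=> [|a x y] /=; first exact: cf0.
    by rewrite cfD !c0 rmorphM /= => -> ->; rewrite mulr0 addr0.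
  move=> _ [a a0 <-] /=; rewrite -monoE cf_mono; case: eqP => // av.
  by case/eqP: a0; apply: val_inj.
move=> f0 I [[I0 ID] IM]; rewrite (mono_expand f) big_seq.
elim/big_rec: _ => // a g; rewrite -mcoeff_neq0 => fa Ig.
have -> : mono a (mcoeff a f) = mono (expo0 M) (mcoeff a f) * mono a 1.
  by rewrite monoM mulr1; congr mono; apply: val_inj; rewrite /= add0r.
apply: ID => //; apply: IM; exists a; rewrite ?monoE //=.
by apply: contraNneq fa => ->; rewrite -c0 f0.
Qed.

Lemma malgC_mono c : malgC c = mono (monalg.one : expo M) c.
Proof. by rewrite monoE. Qed.

Lemma mmap_mono (S : nzRingType) (F : {additive k -> S}) (h : expo M -> S) a c :
  mmap F h (mono a c) = F c * h a.
Proof. by rewrite monoE mmapU. Qed.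

End SemigroupRing.

(** * Frobenius-semilinear functionals on the field *)

Section FrobeniusFunctional.
Variables (k : fieldType) (Q : nat).
Hypothesis (QD : {morph (fun x : k => x ^+ Q) : x y / x + y}) (Q0 : (0 < Q)%N).

Let QN (x : k) : (- x) ^+ Q = - x ^+ Q.
Proof.
by apply/eqP; rewrite -addr_eq0 addrC -QD subrr expr0n gtn_eqF.
Qed.

Let semispace (H : set k) :=
  (forall x y, H x -> H y -> H (x - y)) /\ (forall c x, H x -> H (c ^+ Q * x)).

(** A maximal [k^Q]-subspace avoiding [u] is a complement of the line [k^Q u], and [lam v] is the
    [c] with [v - c^Q u] in it. Zorn's lemma covers fields of infinite degree over [k^Q]. *)
Lemma frobenius_functional (u : k) : u != 0 ->
  exists lam : {additive k -> k},
    lam u = 1 /\ forall c x, lam (c ^+ Q * x) = c * lam x.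
Proof.
move=> u0; pose P (H : set k) := semispace H /\ ~ H u.
have [H [[[HB HZ] Hu] Hmax]] : exists H, P H /\ forall H', H `<` H' -> ~ P H'.
  apply: Zorn_bigcup => F FP Ftot; split; last by move=> [H FH]; exact: (FP H FH).2.
  split=> [x y [H FH Hx] [H' FH' Hy]|c x [H FH Hx]]; last first.
    by exists H => //; apply: (FP H FH).1.2.
  have [HH'|H'H] := Ftot H H' FH FH'.
    by exists H' => //; apply: (FP H' FH').1.1 => //; exact: HH'.
  by exists H => //; apply: (FP H FH).1.1 => //; exact: H'H.
(* [semispace] admits the empty set; maximality against the zero subspace excludes it. *)
have H0 : H 0.
  apply: contrapT => nH0.
  have HE x : ~ H x by move=> Hx; apply: nH0; rewrite -(subrr x); exact: HB.
  apply: (Hmax [set 0]).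
    rewrite properEneq; split; last by move=> x /HE.
    by apply/eqP => HE0; apply: nH0; rewrite HE0.
  split; last by move=> /= /eqP; rewrite (negPf u0).
  by split=> [x y -> ->|c x ->] /=; rewrite ?subrr ?mulr0.
have HN x : H x -> H (- x) by move=> Hx; rewrite -sub0r; exact: HB.
have HD x y : H x -> H y -> H (x + y).
  by move=> Hx Hy; rewrite -[y]opprK; apply: HB => //; exact: HN.
have ex v : exists c, H (v - c ^+ Q * u).
  have [Hv|Hv] := pselect (H v); first by exists 0; rewrite expr0n gtn_eqF // mul0r subr0.
  (* For [v] outside [H], the larger subspace [H + k^Q v] must contain [u], and this relation is
     solved for [v]. *)
  pose H' := [set x | exists c, H (x - c ^+ Q * v)].
  have [c Hc] : H' u.
    apply: contrapT => H'u; apply: (Hmax H').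
      rewrite properEneq; split; last first.
        by move=> x Hx; exists 0; rewrite expr0n gtn_eqF // mul0r subr0.
      apply/eqP => HH'; apply: Hv; rewrite HH'; exists 1.
      by rewrite expr1n mul1r subrr.
    split=> //; split=> [x y [c Hc] [d Hd]|c x [d Hd]].
      exists (c - d); rewrite QD QN (_ : _ - _ = (x - c ^+ Q * v) - (y - d ^+ Q * v)); last by ring.
      exact: HB.
    exists (c * d); rewrite exprMn (_ : _ - _ = c ^+ Q * (x - d ^+ Q * v)); last by ring.
    exact: HZ.
  have c0 : c != 0.
    by apply: contra_notN Hu => /eqP c0; move: Hc; rewrite c0 expr0n gtn_eqF // mul0r subr0.
  exists c^-1; rewrite (_ : _ - _ = - (c^-1 ^+ Q * (u - c ^+ Q * v))); first exact/HN/HZ.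
  by rewrite mulrBr mulrA -exprMn mulVf // expr1n mul1r opprB.
have uniqc v c d : H (v - c ^+ Q * u) -> H (v - d ^+ Q * u) -> c = d.
  move=> Hc Hd; apply/eqP; rewrite -subr_eq0; apply: contra_notT Hu => cd.
  rewrite (_ : u = (c - d)^-1 ^+ Q * ((c - d) ^+ Q * u)); last first.
    by rewrite mulrA -exprMn mulVf // expr1n mul1r.
  apply: HZ; rewrite QD QN.
  rewrite (_ : _ * _ = (v - d ^+ Q * u) - (v - c ^+ Q * u)); last by ring.
  exact: HB.
pose lam v := sval (cid (ex v)).
have lamP v : H (v - lam v ^+ Q * u) by exact: (svalP (cid (ex v))).
have lamB : additive lam.
  move=> x y; apply: (uniqc (x - y)); first exact: lamP.
  rewrite QD QN (_ : _ - _ = (x - lam x ^+ Q * u) - (y - lam y ^+ Q * u)); last by ring.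
  exact: HB.
pose lamA : {additive k -> k} := HB.pack lam (GRing.isZmodMorphism.Build k k lam lamB).
exists lamA; split=> [|c x].
  by apply: (uniqc u); [exact: lamP|rewrite expr1n mul1r subrr].
apply: (uniqc (c ^+ Q * x)); first exact: lamP.
by rewrite exprMn (_ : _ - _ = c ^+ Q * (x - lam x ^+ Q * u)); [exact: HZ|ring].
Qed.

End FrobeniusFunctional.

(** [F] maps any basis of the quotient to the rows of an invertible square matrix, which pins down
    the value chosen in [quot_dim]. *)
Lemma quot_dimE (k : fieldType) (W : lmodType k) (I : set W) n
    (F : {linear W -> 'rV[k]_n}) :
  (forall f, I f <-> F f = 0) -> (forall v, exists f, F f = v) ->
  quot_dim I = n.
Proof.
move=> IF Fsurj.
have uniqn m : (exists b : 'I_m -> W, quot_basis I b) -> m = n.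
  move=> [b [bfree bgen]]; pose B : 'M[k]_(m, n) := \matrix_i F (b i).
  have FB (c : 'I_m -> k) : F (\sum_i c i *: b i) = (\row_i c i) *m B.
    rewrite linear_sum mulmx_sum_row; apply: eq_bigr => i _.
    by rewrite linearZ /= mxE rowK.
  have freeB : row_free B.
    apply: inj_row_free => v vB; apply/rowP => i; rewrite mxE.
    apply: (bfree (fun i => v 0 i)); apply/IF; rewrite FB -[RHS]vB.
    by congr (_ *m _); apply/rowP => j; rewrite mxE.
  have fullB : row_full B.
    rewrite -sub1mx; apply/row_subP => i; have [f fi] := Fsurj (row i 1%:M).
    have [c /IF] := bgen f; rewrite linearB /= FB fi => /eqP.
    by rewrite subr_eq0 => /eqP ->; exact: submxMl.
  by move: freeB fullB; rewrite /row_free /row_full => /eqP rm /eqP rn; rewrite -rm.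
rewrite /quot_dim; case: xgetP => [m _ /uniqn//|/(_ n)[]].
have [b bP] := choice (fun i : 'I_n => Fsurj (delta_mx 0 i)).
have FB (c : 'I_n -> k) : F (\sum_i c i *: b i) = \row_i c i.
  rewrite linear_sum [RHS]row_sum_delta; apply: eq_bigr => i _.
  by rewrite linearZ /= bP mxE.
exists b; split=> [c /IF|f].
  by rewrite FB => /rowP c0 i; have := c0 i; rewrite !mxE.
exists (fun i => F f 0 i); apply/IF; rewrite linearB /= FB.
by apply/eqP; rewrite subr_eq0; apply/eqP/rowP => i; rewrite mxE.
Qed.

Section SplitIdeal.
Variables (k : fieldType) (q : nat) (M : affine_monoid q) (p : nat).
Variable chkp : p \in [pchar k].
Let chRp := pchar_sgring M chkp.
Local Notation SR := (sgring k M).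
Implicit Types (a b d : expo M) (f g : SR) (v w : 'rV[int]_q) (c : k).

Lemma pchar_gt0 e : (0 < p ^ e)%N.
Proof. by rewrite expn_gt0 prime_gt0 // (pcharf_prime chkp). Qed.

(** Compare the coefficients of [x^a]: the left one is the constant coefficient of [f], the right
    one is that of [g] at [a - b], outside M. *)
Lemma cf0_shift a b f g : mono a 1 * f = mono b 1 * g ->
  ~ am_set M (expo_val a - expo_val b) -> cf 0 f = 0.
Proof.
move=> eqfg Mab.
have := etrans (esym (cf_monoM (expo_val a) a 1 f))
  (etrans (congr1 (cf (expo_val a)) eqfg) (cf_monoM (expo_val a) b 1 g)).
by rewrite !mul1r subrr (cf_out g Mab).
Qed.

(* If [b + p^e g] is in [M] and [g = u - v] is not, then
   [x^u phi((c x^b)^(1/p^e)) = x^v phi((c x^(b + p^e g))^(1/p^e))], and the right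
   side does not involve [x^u]. *)
Lemma split_ideal_sub e f (phi : {linear Defs.froot chRp e -> SR^o}) :
  (forall v, wset M (p ^ e) v -> cf v f = 0) ->
  @hmax k q M (phi (to_root chRp e f)).
Proof.
move=> Wf; apply/hmaxP.
rewrite (mono_expand f).
have -> : phi (to_root chRp e (\sum_(a <- msupp f) mono a (mcoeff a f))) =
    \sum_(a <- msupp f) phi (to_root chRp e (mono a (mcoeff a f))).
  exact: raddf_sum.
rewrite cf_sum big_seq big1 // => b; rewrite -mcoeff_neq0.
set c := mcoeff b f => c0.
have /asboolPn Wb : ~~ `[< wset M (p ^ e) (expo_val b) >].
  by apply: contra_neqN c0 => /asboolP /Wf; rewrite -mcoeffE_cf.
have [g [Gg Mbg Mg]] : exists g : 'rV[int]_q, [/\ group_gen (am_set M) g,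
    am_set M (expo_val b + g *+ (p ^ e)) & ~ am_set M g].
  apply: contrapT => H; apply: Wb; split; first exact: expoP.
  by move=> g Gg Mbg; apply: contrapT => Mg; apply: H; exists g.
have [u [v [Mu Mv guv]]] := (group_genP _ (submonoid_am M)).1 Gg.
have lift w : am_set M w -> exists a : expo M, expo_val a = w.
  by move=> Mw; exists (Expo (asboolT Mw)).
have [U UE] := lift u Mu; have [V VE] := lift v Mv; have [Bg BgE] := lift _ Mbg.
have shift (a d : expo M) : mono a 1 * phi (to_root chRp e (mono d c)) =
    phi (to_root chRp e (mono a 1 ^+ (p ^ e) * mono d c)).
  exact: (esym (linearZZ phi (mono a 1) (to_root chRp e (mono d c)))).
have [U' U'E UX] := monoX U (1 : k) (p ^ e).
have [V' V'E VX] := monoX V (1 : k) (p ^ e).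
have eqv : expo_val U' + expo_val b = expo_val V' + expo_val Bg.
  rewrite U'E V'E UE VE BgE guv mulrnBl.
  by rewrite [RHS]addrCA [X in _ = _ + X]addrC subrK addrC.
have eqUV : monalg.mul U' b = monalg.mul V' Bg by exact: val_inj.
have eqm' : mono U' ((1 : k) ^+ (p ^ e)) * mono b c = mono V' ((1 : k) ^+ (p ^ e)) * mono Bg c.
  apply: (etrans (monoM _ _ _ _)); apply: (etrans _ (esym (monoM _ _ _ _))).
  exact: (congr1 (fun z => mono z _) eqUV).
have eqm := etrans (congr1 (fun z => z * mono b c) UX)
  (etrans eqm' (esym (congr1 (fun z => z * mono Bg c) VX))).
have UV : mono U 1 * phi (to_root chRp e (mono b c)) =
    mono V 1 * phi (to_root chRp e (mono Bg c)).
  have Hphi := congr1 (fun z : SR => phi (to_root chRp e z)) eqm.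
  exact: (etrans (shift U b) (etrans Hphi (esym (shift V Bg)))).
by apply: (cf0_shift UV); rewrite UE VE -guv.
Qed.

(** This combines [lam] on coefficients with the [Q]-th root of monomials shifted by [v]. The
    exponent [(b - v) / Q] is unique because the lattice is torsion free, so the choice made in [h]
    is harmless. *)
Lemma shifted_root_map (lam : {additive k -> k}) v Q : (0 < Q)%N ->
  exists phi : SR -> SR, [/\ additive phi,
    forall b (g : expo M) c, expo_val b = v + expo_val g *+ Q -> phi (mono b c) = mono g (lam c)
  & forall b c, ~ (exists g : expo M, expo_val b = v + expo_val g *+ Q) ->
      phi (mono b c) = 0].
Proof.
move=> Q0; pose lamC : {additive k -> SR} := (malgC : {additive k -> SR}) \o lam.
pose h (b : expo M) : SR :=
  if pselect (exists g : expo M, expo_val b = v + expo_val g *+ Q) is left H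
  then mono (projT1 (cid H)) 1 else 0.
exists (mmap lamC h); split; first exact: mmap_is_additive.
- move=> b g c bg; rewrite mmap_mono /h; case: pselect => [H|[]]; last by exists g.
  case: cid => g' /= bg'; have -> : g' = g.
    apply: val_inj; apply/rowP => i.
    have /rowP/(_ i) : expo_val g' *+ Q = expo_val g *+ Q.
      by apply: (addrI v); rewrite -bg -bg'.
    rewrite !mulmxnE => /eqP; rewrite eqr_pMn2r //.
    by move/eqP.
  rewrite malgC_mono monoM mulr1; congr mono.
  by apply: val_inj; rewrite /= add0r.
- by move=> b c H; rewrite mmap_mono /h; case: pselect => // _; rewrite mulr0.
Qed.

Lemma frobenius_sum (I : Type) (s : seq I) (F : I -> SR) e :
  (\sum_(i <- s) F i) ^+ (p ^ e) = \sum_(i <- s) F i ^+ (p ^ e).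
Proof.
have QDR : {morph (fun x : SR => x ^+ (p ^ e)) : x y / x + y}.
  by move=> x y /=; rewrite exprDn_pchar // pnatX pnatE ?chRp // (pcharf_prime chRp).
by apply: (big_morph _ QDR); rewrite expr0n gtn_eqF // pchar_gt0.
Qed.

Lemma frobenius_linear_ext e (phi : SR -> SR) : additive phi ->
  (forall a c b c', phi (mono a c ^+ (p ^ e) * mono b c') = mono a c * phi (mono b c')) ->
  forall r f, phi (r ^+ (p ^ e) * f) = r * phi f.
Proof.
move=> phiB key r f.
pose phiA : {additive SR -> SR} := HB.pack phi (GRing.isZmodMorphism.Build _ _ phi phiB).
have phiS (I : Type) (s : seq I) (G : I -> SR) :
    phi (\sum_(i <- s) G i) = \sum_(i <- s) phi (G i).
  exact: (raddf_sum phiA).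
transitivity (\sum_(a <- msupp r) \sum_(b <- msupp f)
    phi (mono a (mcoeff a r) ^+ (p ^ e) * mono b (mcoeff b f))).
  rewrite {1}(mono_expand r) frobenius_sum mulr_suml phiS; apply: eq_bigr => a _.
  by rewrite {1}(mono_expand f) mulr_sumr phiS.
rewrite [in RHS](mono_expand r) mulr_suml; apply: eq_bigr => a _.
rewrite [in RHS](mono_expand f) phiS mulr_sumr; apply: eq_bigr => b _.
exact: key.
Qed.

(** The map is the shifted root map at [v], with [lam] normalised to 1 at the coefficient of [f]
    there; the image of [f] then has constant coefficient 1. *)
Lemma split_ideal_sup e f v : wset M (p ^ e) v -> cf v f != 0 ->
  exists phi : {linear Defs.froot chRp e -> SR^o}, ~ @hmax k q M (phi (to_root chRp e f)).
Proof.
move=> Wv fv.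
have Q0 := pchar_gt0 e.
have QD : {morph (fun x : k => x ^+ (p ^ e)) : x y / x + y}.
  by move=> x y /=; rewrite exprDn_pchar // pnatX pnatE ?chkp // (pcharf_prime chkp).
have [lam [lamu lamZ]] := frobenius_functional QD Q0 fv.
have [phi0 [phi0B phi01 phi00]] := shifted_root_map lam v Q0.
have key a c b c' : phi0 (mono a c ^+ (p ^ e) * mono b c') = mono a c * phi0 (mono b c').
  have [a' a'E aX] := monoX a c (p ^ e).
  apply: (etrans (congr1 (fun z => phi0 (z * _)) aX)).
  apply: (etrans (congr1 phi0 (monoM _ _ _ _))).
  have [[g bg]|H] := pselect (exists g : expo M, expo_val b = v + expo_val g *+ (p ^ e)).
    have abg : expo_val (monalg.mul a' b) =
        v + expo_val (monalg.mul a g : expo M) *+ (p ^ e).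
      by rewrite /= a'E bg addrCA mulrnDl.
    apply: (etrans (phi01 _ _ _ abg)).
    apply: (etrans _ (esym (congr1 (fun z => mono a c * z) (phi01 _ _ _ bg)))).
    by apply: (etrans _ (esym (monoM _ _ _ _))); rewrite lamZ.
  (* Linearity rests on [v] being in W_{p^e}: if [p^e a + b = v + p^e g], then [b = v + p^e (g - a)]
     forces [g - a] into M, so the two sides vanish together. *)
  rewrite (phi00 b c' H) mulr0; apply: phi00 => -[g /= abg]; apply: H.
  have bE : expo_val b = v + (expo_val g - expo_val a) *+ (p ^ e).
    by rewrite mulrnBl addrA -abg a'E addrAC subrr add0r.
  have Mga : am_set M (expo_val g - expo_val a).
    apply: Wv.2; last by rewrite -bE; exact: expoP.
    apply/(group_genP _ (submonoid_am M)); exists (expo_val g), (expo_val a).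
    by split=> //; exact: expoP.
  by exists (Expo (asboolT Mga)).
pose phi1 : Defs.froot chRp e -> SR^o := phi0.
have phi1Z : scalable phi1.
  by move=> r g; exact: (frobenius_linear_ext phi0B key).
have phi1B : additive phi1 by exact: phi0B.
pose phi : {linear Defs.froot chRp e -> SR^o} := HB.pack phi1
  (GRing.isZmodMorphism.Build _ _ phi1 phi1B) (GRing.isScalable.Build _ _ _ _ phi1 phi1Z).
exists phi => /hmaxP H.
have {}H : cf 0 (phi0 f) = 0 by exact: H.
pose phiA : {additive SR -> SR} := HB.pack phi0 (GRing.isZmodMorphism.Build _ _ phi0 phi0B).
have phiS : phi0 f = \sum_(b <- msupp f) phi0 (mono b (mcoeff b f)).
  by rewrite {1}(mono_expand f); exact: (raddf_sum phiA).
have [V VE] : exists a : expo M, expo_val a = v.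
  by exists (Expo (asboolT (cf_neq0 fv))).
have Vf : V \in msupp f by rewrite -mcoeff_neq0 mcoeffE_cf VE.
move: H; rewrite phiS cf_sum (bigD1_seq V) ?fset_uniq //=.
have -> : phi0 (mono V (mcoeff V f)) = mono (expo0 M) 1.
  rewrite (phi01 V (expo0 M)); last by rewrite /= mul0rn addr0.
  by rewrite mcoeffE_cf VE lamu.
rewrite cf_mono eqxx big1 ?addr0 => [/eqP|b bV]; first by rewrite oner_eq0.
have [[g bg]|/phi00 ->] := pselect (exists g : expo M, expo_val b = v + expo_val g *+ (p ^ e)).
  rewrite (phi01 b g) // cf_mono; case: eqP => // g0; case/eqP: bV; apply: val_inj.
  by rewrite /= bg g0 mul0rn addr0 VE.
by rewrite cf0.
Qed.

Lemma split_idealP e f : split_ideal (@hmax k q M) chRp e f <->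
  forall v, wset M (p ^ e) v -> cf v f = 0.
Proof.
split=> [H v Wv|H phi]; last exact: split_ideal_sub.
apply/eqP; apply: contrapT => /negP fv.
by have [phi] := split_ideal_sup Wv fv; apply.
Qed.

Lemma split_codimE e : split_codim M chkp e = size (wseq M (p ^ e)).
Proof.
pose w := wseq M (p ^ e).
pose F (f : SR) : 'rV[k]_(size w) := \row_i cf w`_i f.
have Flin : linear F.
  by move=> c f g; apply/rowP => i; rewrite !mxE cfD cfZ.
pose FL : {linear SR -> 'rV[k]_(size w)} := HB.pack F (GRing.isLinear.Build _ _ _ _ F Flin).
apply: (@quot_dimE _ _ _ _ FL).
  move=> f; rewrite split_idealP; split=> [H|/rowP H v /wseqP vw].
    by apply/rowP => i; rewrite !mxE; apply: H; apply/wseqP; exact: mem_nth.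
  have vi : (index v w < size w)%N by rewrite index_mem.
  by have := H (Ordinal vi); rewrite !mxE /= nth_index.
move=> v.
have wM (i : 'I_(size w)) : am_set M w`_i.
  by apply: (@wset_am _ _ (p ^ e)); apply/wseqP; exact: mem_nth.
exists (\sum_i mono (Expo (asboolT (wM i))) (v 0 i)).
apply/rowP => j; rewrite mxE cf_sum (bigD1 j) //= cf_mono eqxx big1 ?addr0 // => i ij.
rewrite cf_mono /= nth_uniq ?wseq_uniq //.
by rewrite (inj_eq (@ord_inj _)) (negPf ij).
Qed.

Definition face_ideal (N : set 'rV[int]_q) : set SR :=
  [set f | forall v, N v -> cf v f = 0].

Lemma split_primeE : wset M p 0 ->
  split_prime (@hmax k q M) chRp = face_ideal (face_monoid M).
Proof.
have p1 : (1 < p)%N := prime_gt1 (pcharf_prime chkp).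
move=> Wp; rewrite eqEsubset; split=> f; last first.
  move=> Nf e e0; apply/split_idealP => v Wv; apply: Nf; exists (p ^ e)%N => //.
  by rewrite /= -(expn0 p) ltn_exp2l.
(* The exponent [m + 1] is positive and satisfies [m <= p^(m + 1)], so W_m lies in the corresponding
   set. *)
move=> Pf v [m m1 Wv]; have /= := Pf m.+1 isT.
move=> /split_idealP; apply; apply: wset_mono Wv; first exact: wset0X.
by rewrite (leq_trans (ltnW (ltn_expl m p1))) // leq_exp2l.
Qed.

End SplitIdeal.

(** * Krull dimension *)

Section PrimeChains.
Variable R : comNzRingType.
Implicit Types (I : set R) (x y a : R).

Lemma idealM I a x : ideal I -> I x -> I (a * x).
Proof. by move=> [I0 ID] Ix; rewrite -[a * x]addr0; exact: ID. Qed.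

Lemma idealD I x y : ideal I -> I x -> I y -> I (x + y).
Proof. by move=> [I0 ID] Ix Iy; rewrite -[x]mul1r; exact: ID. Qed.

Lemma idealB I x y : ideal I -> I x -> I y -> I (x - y).
Proof. by move=> [I0 ID] Ix Iy; rewrite addrC -mulN1r; exact: ID. Qed.

Lemma ideal_sum I (T : Type) (s : seq T) (P : pred T) (F : T -> R) :
  ideal I -> (forall t, P t -> I (F t)) -> I (\sum_(t <- s | P t) F t).
Proof.
move=> Iid IF; elim/big_rec: _ => [|t x /IF]; first by case: Iid.
exact: idealD.
Qed.

Lemma primeX I x n : prime_ideal I -> I (x ^+ n) -> I x.
Proof.
move=> [Iid I1 Ipr]; elim: n => [|n IH]; first by rewrite expr0.
by rewrite exprS => /Ipr[].
Qed.

End PrimeChains.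

(* Divide the relation successively by the least powers of the [x i]: what
   remains modulo [C n] is a nonzero constant. *)
Lemma chain_independent (k : fieldType) (A : comAlgType k) n (C : nat -> set A)
    (x : 'I_n -> A) D (ka : {ffun 'I_n -> 'I_D} -> k) :
  (forall i, (i <= n)%N -> prime_ideal (C i)) ->
  (forall i : 'I_n, C i `<=` C i.+1) ->
  (forall i : 'I_n, ~ C i (x i)) -> (forall i : 'I_n, C i.+1 (x i)) ->
  C 0%N (\sum_t ka t *: \prod_i x i ^+ t i) -> forall t, ka t = 0.
Proof.
move=> Cpr CS xnC xC C0 t0; apply: contrapT => /eqP kt0.
pose agree i (t t' : {ffun 'I_n -> 'I_D}) :=
  [forall j : 'I_n, (j < i)%N ==> (t j == t' j)].
(* [S i t'] keeps the terms whose first [i] exponents are those of [t'], with the powers of these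
   first [i] elements removed. *)
pose S i t' := \sum_(t | agree i t t') ka t *: \prod_(j < n | (i <= j)%N) x j ^+ t j.
have claim i : (i <= n)%N -> exists t', ka t' != 0 /\ C i (S i t').
  elim: i => [_|i IH i_n].
    exists t0; split=> //; move: C0; congr (C 0%N _).
    by apply: eq_big => // t; symmetry; apply/forallP.
  have [t1 [kt1 Ct1]] := IH (ltnW i_n); pose I := Ordinal i_n.
  pose P := [pred t | agree i t t1 && (ka t != 0)].
  have Pt1 : P t1 by rewrite /= kt1 andbT; apply/forallP => j; rewrite eqxx implybT.
  (* The least exponent of [x I] among the remaining nonzero terms: this power factors out and is
     cancelled modulo the prime [C i]. *)
  case: (arg_minnP (fun t : {ffun 'I_n -> 'I_D} => nat_of_ord (t I)) Pt1) => t2 /andP[agr2 kt2] t2min.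
  exists t2; split=> //.
  have [Cid C1 Cmul] := Cpr i (ltnW i_n); have [Cid' _ _] := Cpr i.+1 i_n.
  pose T (j : nat) (t : {ffun 'I_n -> 'I_D}) := \prod_(l < n | (j <= l)%N) x l ^+ t l.
  have TI t : T i t = x I ^+ t I * T i.+1 t.
    rewrite /T (bigD1 I) //=; congr (_ * _); apply: eq_bigl => l.
    by rewrite ltn_neqAle eq_sym andbC.
  pose Y := \sum_(t | agree i t t1) ka t *: (x I ^+ (t I - t2 I) * T i.+1 t).
  have SY : S i t1 = x I ^+ t2 I * Y.
    rewrite /S /Y mulr_sumr; apply: eq_bigr => t agr.
    rewrite -/(T i t) -scalerAr.
    have [->|kt] := eqVneq (ka t) 0; first by rewrite !scale0r.
    by rewrite mulrA -exprD subnKC ?TI // t2min //= agr.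
  have CY : C i.+1 Y.
    apply: (CS I); have := Ct1; rewrite SY => /Cmul[Cx|//].
    by case: (xnC I); exact: primeX (Cpr i (ltnW i_n)) Cx.
  have split_t t : agree i.+1 t t2 = agree i t t1 && (t I == t2 I).
    apply/forallP/andP => [H|[/forallP H /eqP HI] j].
      split; last by have := H I; rewrite ltnSn.
      apply/forallP => j; apply/implyP => ji; have := H j; rewrite ltnS (ltnW ji) /=.
      by move=> /eqP ->; have /forallP/(_ j) := agr2; rewrite ji.
    apply/implyP; rewrite ltnS leq_eqVlt => /predU1P[ji|ji].
      by have -> : j = I by [apply: val_inj]; rewrite HI.
    by have := H j; have /forallP/(_ j) := agr2; rewrite ji /= => /eqP-> /eqP->.
  have -> : S i.+1 t2 = Y - \sum_(t | agree i t t1 && (t I != t2 I))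
      ka t *: (x I ^+ (t I - t2 I) * T i.+1 t).
    rewrite /Y (bigID (fun t : {ffun 'I_n -> 'I_D} => t I == t2 I)) /= addrK.
    apply: eq_big => [t|t]; first exact: split_t.
    by rewrite split_t => /andP[_ /eqP ->]; rewrite subnn expr0 mul1r.
  apply: idealB => //; apply: ideal_sum => // t /andP[agr tI].
  have [->|kt] := eqVneq (ka t) 0; first by rewrite scale0r; case: Cid'.
  have lt : (t2 I < t I)%N by rewrite ltn_neqAle eq_sym tI t2min //= agr.
  rewrite -mulr_algl; apply: idealM => //; rewrite mulrC; apply: idealM => //.
  by rewrite -(subnSK lt) exprS mulrC; apply: idealM => //; exact: (xC I).
have [t1 [kt1]] := claim n (leqnn n).
rewrite /S (big_pred1 t1) => [|t]; last first.
  apply/forallP/eqP => [H|-> j]; last by rewrite eqxx implybT.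
  by apply/ffunP => j; have := H j; rewrite ltn_ord => /eqP.
rewrite big1 => [|j]; last by rewrite leqNgt ltn_ord.
have [Cid C1 _] := Cpr n (leqnn n) => Ck; apply: C1.
have -> : 1 = (ka t1)^-1%:A * (ka t1 *: 1) :> A.
  by rewrite mulr_algl scalerA mulVf // scale1r.
exact: idealM.
Qed.

Lemma linear_dependence (k : fieldType) (T U : finType) (F : T -> U -> k) :
  (#|U| < #|T|)%N ->
  exists2 ka : T -> k, exists t, ka t != 0 & forall u, \sum_t ka t * F t u = 0.
Proof.
move=> UT; pose B := \matrix_(i < #|T|, j < #|U|) F (enum_val i) (enum_val j).
have : kermx B != 0.
  rewrite kermx_eq0 /row_free neq_ltn (leq_ltn_trans _ UT) //.
  exact: rank_leq_col.
case/rowV0Pn => v /sub_kermxP vB v0.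
exists (fun t => v 0 (enum_rank t)).
  have [i vi] : exists i, v 0 i != 0.
    apply: contrapT => H; case/eqP: v0; apply/rowP => i; rewrite mxE.
    by apply/eqP; apply: contrapT => /negP vi; apply: H; exists i.
  by exists (enum_val i); rewrite enum_valK.
move=> u; have /rowP/(_ (enum_rank u)) := vB; rewrite !mxE => H; rewrite -[RHS]H.
rewrite (reindex (@enum_val T predT)) /=; last first.
  by exists enum_rank => ? _; rewrite ?enum_valK ?enum_rankK.
by apply: eq_bigr => i _; rewrite enum_valK mxE enum_rankK.
Qed.

Section Degree.
Variables (k : fieldType) (q : nat) (M : affine_monoid q).
Local Notation SR := (sgring k M).
Implicit Types (f g : SR) (v : 'rV[int]_q).

Definition degle d f := forall v, cf v f != 0 -> forall j, v ord0 j <= d%:Z.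

Lemma cf_msupp v f : cf v f != 0 -> exists2 a, a \in msupp f & expo_val a = v.
Proof.
move=> fv; exists (Expo (asboolT (cf_neq0 fv))) => //.
by rewrite -mcoeff_neq0 mcoeffE_cf.
Qed.

Lemma degleM d e f g : degle d f -> degle e g -> degle (d + e) (f * g).
Proof.
move=> df eg v /cf_msupp[_ /msuppM_le[a [b [af bg ->]]] <-] j.
rewrite /= mxE PoszD lerD //.
  by apply: df; rewrite -mcoeffE_cf mcoeff_neq0.
by apply: eg; rewrite -mcoeffE_cf mcoeff_neq0.
Qed.

Lemma degle1 : degle 0 1.
Proof.
move=> v; rewrite -[1](monoE (monalg.one : expo M)) cf_mono.
by case: (_ =P v) => [<- _ j|]; rewrite ?eqxx //= mxE.
Qed.

Lemma degleW d e f : (d <= e)%N -> degle d f -> degle e f.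
Proof. by move=> de df v fv j; apply: le_trans (df v fv j) _; rewrite lez_nat. Qed.

Lemma degleX d f n : degle d f -> degle (n * d) (f ^+ n).
Proof.
move=> df; elim: n => [|n IH]; first by rewrite expr0; exact: degle1.
by rewrite exprS mulSn; exact: degleM.
Qed.

Lemma degle_prod n d (F : 'I_n -> SR) :
  (forall i, degle d (F i)) -> degle (n * d) (\prod_i F i).
Proof.
elim: n F => [|n IH] F dF; first by rewrite big_ord0; exact: degle1.
by rewrite big_ord_recl mulSn; apply: degleM => //; apply: IH.
Qed.

Lemma degle_ex f : exists d, degle d f.
Proof.
exists (\sum_(a <- msupp f) \sum_j `|expo_val a ord0 j|)%N => v /cf_msupp[a af <-] j.
rewrite (bigD1_seq a) ?fset_uniq //= (bigD1 j) //=; lia.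
Qed.

End Degree.

Section KrullDim.
Variables (k : fieldType) (q : nat) (M : affine_monoid q) (N : set 'rV[int]_q).
Hypothesis NM : N `<=` am_set M.
Local Notation SR := (sgring k M).
Let r := mrank N.

(** A longer chain gives [r + 1] elements [x i] in [C i.+1] outside [C i]. Their products with
    exponents below [D] outnumber the vectors of N that can occur in them, so some combination lies
    in the face ideal, against [chain_independent]. *)
Lemma chain_length_le n : prime_chain (@face_ideal k q M N) n -> (n <= r)%N.
Proof.
have [G [c [GN detA frameP]]] := frame N.
have finj := frame_inj detA frameP.
move=> [C [Cpr CS]]; rewrite leqNgt; apply/negP => rn.
have ex (i : 'I_r.+1) : exists y : SR, C i.+1 y /\ ~ C i y.
  have [_ /nonsubset[y [Cy Cy']]] := CS i (leq_trans (ltn_ord i) rn).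
  by exists y.
have [x xP] := choice ex.
have [d dP] : exists d, forall i, degle d (x i).
  have [d dP] := choice (fun i => degle_ex (x i)).
  exists (\sum_i d i)%N => i; apply: degleW (dP i).
  by rewrite (bigD1 i) //= leq_addr.
(* [K] keeps the degrees of the products below [B = K D], and [D > K^r] gives [B^r < D^(r + 1)]:
   fewer equations than unknowns. *)
pose K := (r.+1 * (d.+1))%N.
pose D := (K ^ r).+1; pose B := (K * D)%N.
have BD : (B ^ r < D ^ r.+1)%N by rewrite expnMn expnS ltn_pmul2r // expn_gt0.
pose mon (t : {ffun 'I_r.+1 -> 'I_D}) : SR := \prod_i x i ^+ t i.
have monB t v : cf v (mon t) != 0 -> forall j, v ord0 j < B%:Z.
  have : degle (r.+1 * (D.-1 * d)) (mon t).
    apply: degle_prod => i /=; apply: (@degleW _ _ _ (t i * d)); last exact: degleX.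
    by apply: leq_mul => //; rewrite -ltnS; exact: (ltn_ord (t i)).
  move=> H /H + j => /(_ j) /le_lt_trans; apply.
  by rewrite ltz_nat /B /K -mulnA ltn_pmul2l //; rewrite /D /=; nia.
(* At most one vector of N has given coordinates along [c]; where there is none, the default 0 only
   adds a harmless equation. *)
pose vec (u : {ffun 'I_r -> 'I_B}) : 'rV[int]_q :=
  xget 0 [set v | N v /\ forall j, v ord0 (c j) = (u j)%:Z].
have [|ka [t kt] kaP] := linear_dependence (fun t u => if `[< N (vec u) >] then cf (vec u) (mon t) else 0).
  by rewrite !card_ffun !card_ord.
case/eqP: kt; apply: (@chain_independent _ _ r.+1 C x D ka) => //.
- by move=> i ir; apply: (Cpr i (leq_trans ir rn)).1.
- by move=> i; apply: properW; exact: CS i (leq_trans (ltn_ord i) rn).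
- by move=> i; case: (xP i).
- by move=> i; case: (xP i).
apply: (Cpr 0%N _).2 => // v Nv.
rewrite cf_sum; apply/eqP; apply: contrapT => /negP cv.
have [t' ct'] : exists t', cf v (mon t') != 0.
  apply: contrapT => H; case/negP: cv; apply/eqP; apply: big1 => t' _.
  rewrite cfZ; have [->|] := eqVneq (cf v (mon t')) 0; first by rewrite mulr0.
  by move=> ct'; case: H; exists t'.
have vB j : (`|v ord0 (c j)| < B)%N.
  by have := monB t' v ct' (c j); have := am_ge0 (NM Nv) (c j); lia.
pose u := [ffun j => Ordinal (vB j)].
have uv j : v ord0 (c j) = (u j)%:Z by rewrite ffunE /= gez0_abs // (am_ge0 (NM Nv)).
have vecu : vec u = v.
  rewrite /vec; case: xgetP => [w _ [Nw wu]|/(_ v)[]//].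
  apply/eqP; rewrite -subr_eq0; apply/eqP; apply: finj.
    by apply: group_genB; exact: group_gen_sub.
  by move=> j; rewrite !mxE wu uv subrr.
case/negP: cv; apply/eqP; rewrite -[RHS](kaP u); apply: eq_bigr => t'' _ /=.
by rewrite vecu asboolT // cfZ.
Qed.

End KrullDim.

(** * Prime chains from coordinate projections *)

Section MonomialKernels.
Variables (k : fieldType) (q : nat) (M : affine_monoid q).
Local Notation SR := (sgring k M).

Lemma sgring_morphism (S : comNzRingType) (F : {rmorphism k -> S}) (h : expo M -> S) :
  mmorphism h ->
  exists Phi : {rmorphism SR -> S}, forall a c, Phi (mono a c) = F c * h a.
Proof.
move=> hM; pose hm : monalg.MMorphism.type (expo M) S :=
  HB.pack h (monalg.isMultiplicative.Build _ _ h hM).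
by exists (mmap F hm : {rmorphism SR -> S}) => a c; exact: mmap_mono.
Qed.

Lemma kernel_prime (A : comNzRingType) (S : idomainType) (Phi : {rmorphism A -> S}) :
  prime_ideal [set x | Phi x = 0].
Proof.
split=> [|/=|x y /=].
- by split=> [|a x y /= x0 y0]; rewrite /= ?rmorph0 // rmorphD rmorphM x0 y0 mulr0 addr0.
- by rewrite rmorph1 => /eqP; rewrite oner_eq0.
- by rewrite rmorphM => /eqP; rewrite mulf_eq0 => /orP[] /eqP; [left|right].
Qed.

Variable N : set 'rV[int]_q.
Hypotheses (NM : N `<=` am_set M) (Ndc : divisor_closed M N).
Let r := mrank N.
Local Notation P := (mpoly.mpoly r k).

Let Y (i : nat) (j : 'I_r) : P := if (j < i)%N then mpoly.mpolyX k (mpoly.mnm1 j) else 1.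

(** This kills the monomials outside N, which is multiplicative by divisor closure, and keeps the
    first [i] coordinates along [c], the other variables being set to 1. *)
Let h (c : 'I_r -> 'I_q) i (a : expo M) : P :=
  if `[< N (expo_val a) >] then \prod_j Y i j ^+ `|expo_val a ord0 (c j)|%N else 0.

Let h_mmorphism c i : mmorphism (h c i).
Proof.
have N0 : N 0 by case: Ndc => -[].
split=> [a b|]; last first.
  by rewrite /h asboolT // big1 // => j _; rewrite mxE expr0.
rewrite /h /=; have [Na|Na] := pselect (N (expo_val a)); last first.
  rewrite (asboolF Na) mul0r asboolF // => Nab; apply: Na.
  exact: Ndc.2 (expoP a) (expoP b) Nab.
have [Nb|Nb] := pselect (N (expo_val b)); last first.
  rewrite (asboolF Nb) mulr0 asboolF // addrC => Nab; apply: Nb.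
  exact: Ndc.2 (expoP b) (expoP a) Nab.
rewrite !asboolT //; last by apply: Ndc.1.2.
rewrite -big_split; apply: eq_bigr => j _ /=; rewrite -exprD mxE; congr (_ ^+ _).
have := am_ge0 (expoP a) (c j); have := am_ge0 (expoP b) (c j).
move: (expo_val a ord0 (c j)) (expo_val b ord0 (c j)) => x y; lia.
Qed.

Lemma prime_chain_face : prime_chain (@face_ideal k q M N) r.
Proof.
have [G [c [GN detA frameP]]] := frame N.
have ex (i : nat) := sgring_morphism (@mpoly.mpolyC r k) (h_mmorphism c i).
have [Phi PhiP] := choice ex.
have kerN i : @face_ideal k q M N `<=` [set f | Phi i f = 0].
  move=> f fN /=; rewrite (mono_expand f) raddf_sum big1 // => a _.
  rewrite /= PhiP /h; case: asboolP => Na; last by rewrite mulr0.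
  by rewrite mcoeffE_cf fN // rmorph0 mul0r.
have kerS i i' : (i <= i')%N -> [set f | Phi i' f = 0] `<=` [set f | Phi i f = 0].
  move=> ii' f /= f0.
  (* [psi] sets the variables of index at least [i] to 1, so that [Phi i] factors through
     [Phi i']. *)
  pose psi : {rmorphism P -> P} := mpoly.mmap (@mpoly.mpolyC r k) (Y i).
  have psiY j : psi (Y i' j) = Y i j.
    rewrite /Y; case: ifP => ji'; last first.
      by rewrite rmorph1 ifF //; apply: contraFF ji' => /leq_trans; apply.
    by rewrite /psi /= mpoly.mmapX mpoly.mmap1U.
  have -> : Phi i f = psi (Phi i' f); last by rewrite f0 rmorph0.
  rewrite (mono_expand f) !raddf_sum; apply: eq_bigr => a _ /=.
  rewrite !PhiP rmorphM /= mpoly.mmapC; congr (_ * _).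
  rewrite /h; case: asboolP => _; last by rewrite rmorph0.
  by rewrite rmorph_prod; apply: eq_bigr => j _; rewrite rmorphXn /= psiY.
have strict (i : 'I_r) : exists f, Phi i f = 0 /\ Phi i.+1 f <> 0.
  (* By the adjugate identity, the coordinates of [w G] along [c] vanish except the [i]-th, which is
     the minor. With [u - v = w G], the binomial [x^u - x^v] dies under [Phi i] but not under
     [Phi i.+1]. *)
  pose w := row i (\adj (colsub c G)).
  pose u := \sum_l row l G *+ `|(Num.max (w ord0 l) 0)%R|%N.
  pose v := \sum_l row l G *+ `|(Num.max (- w ord0 l) 0)%R|%N.
  have Nu : N u by apply: submonoid_sum; [exact: Ndc.1|move=> l _; apply: submonoidMn; [exact: Ndc.1|exact: GN]].
  have Nv : N v by apply: submonoid_sum; [exact: Ndc.1|move=> l _; apply: submonoidMn; [exact: Ndc.1|exact: GN]].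
  have uvw : u - v = w *m G.
    rewrite mulmx_sum_row /u /v -sumrB; apply: eq_bigr => l _.
    rewrite -!scaler_nat -scalerBl !natz; congr (_ *: _).
    by move: (w ord0 l) => z; lia.
  have uvc j : (u - v) ord0 (c j) = \det (colsub c G) *+ (i == j).
    have : colsub c (u - v) = row i (\det (colsub c G))%:M.
      rewrite uvw -mul_adj_mx row_mul; apply/rowP => l; rewrite !mxE.
      by apply: eq_bigr => l' _; rewrite !mxE.
    by move=> /rowP/(_ j); rewrite !mxE.
  pose U : expo M := Expo (asboolT (NM Nu)); pose V : expo M := Expo (asboolT (NM Nv)).
  have UVc (j : 'I_r) : j != i -> `|u ord0 (c j)|%N = `|v ord0 (c j)|%N.
    move=> ji; have := uvc j; rewrite eq_sym (negPf ji) mulr0n !mxE.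
    by move=> /eqP; rewrite subr_eq0 => /eqP ->.
  exists (mono U 1 - mono V 1); rewrite !rmorphB /= !PhiP rmorph1 !mul1r.
  rewrite /h /= !asboolT //; split.
    apply/eqP; rewrite subr_eq0; apply/eqP; apply: eq_bigr => j _.
    have [->|ji] := eqVneq j i; last by rewrite UVc.
    by rewrite /Y ltnn !expr1n.
  pose mm (x : 'rV[int]_q) : mpoly.multinom r :=
    mpoly.Multinom [tuple (if (j <= i)%N then `|x ord0 (c j)|%N else 0%N) | j < r].
  have YE (x : 'rV[int]_q) : \prod_j Y i.+1 j ^+ `|x ord0 (c j)|%N = mpoly.mpolyX k (mm x).
    rewrite mpoly.mpolyXE_id; apply: eq_bigr => j _.
    by rewrite mpoly.mnmE /Y ltnS; case: ifP => //; rewrite expr1n expr0.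
  rewrite !YE => /eqP; rewrite subr_eq0 => /eqP/(congr1 (mpoly.mcoeff (mm v))).
  rewrite !mpoly.mcoeffX eqxx; case: eqP => [/mpoly.mnmP/(_ i)|_ /eqP]; last first.
    by rewrite eq_sym oner_eq0.
  rewrite !mpoly.mnmE leqnn => uv _; have := uvc i; rewrite eqxx mulr1n !mxE.
  have -> : u ord0 (c i) = v ord0 (c i).
    have := am_ge0 (NM Nu) (c i); have := am_ge0 (NM Nv) (c i); move: uv => /=.
    by move: (u ord0 (c i)) (v ord0 (c i)) => y z; lia.
  by rewrite subrr => /esym/eqP; rewrite (negPf detA).
(* The kernels grow as fewer coordinates are kept, hence the reversed index. *)
exists (fun l => [set f | Phi (r - l)%N f = 0]); split=> l lr.
  by split; [exact: kernel_prime|exact: kerN].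
have il : (r - l.+1 < r)%N by lia.
have [f [f0 f1]] := strict (Ordinal il).
have rl : (r - l = (r - l.+1).+1)%N by lia.
split; first by apply: kerS; rewrite rl.
by move=> /(_ f f0) /=; rewrite rl.
Qed.

Lemma krull_dim_face_ideal : krull_dim (@face_ideal k q M N) = r.
Proof.
have ch := prime_chain_face; have le n := @chain_length_le k q M N NM n.
rewrite /krull_dim; case: xgetP => [n _ [/le nr /(_ _ ch) rn]|/(_ r)[]//].
by apply/eqP; rewrite eqn_leq nr.
Qed.

End MonomialKernels.

(** * Limits *)

Lemma mrankS q (N N' : set 'rV[int]_q) : N `<=` N' -> (mrank N <= mrank N')%N.
Proof.
move=> NN'; have [Y [YN _ QE _]] := Qspan_basis N.
have [Y' [_ _ QE' genY']] := Qspan_basis N'.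
rewrite /mrank QE QE'; apply/dimvS/span_subvP => _ /mapP[y /YN Ny ->].
by apply: genY'; apply: group_gen_sub; exact: NN'.
Qed.

Lemma invn_cvg0 (R : realType) (m : nat -> nat) : (forall t, (t <= m t)%N) ->
  ((m t)%:R^-1 : R) @[t --> \oo] --> (0 : R).
Proof.
move=> tm; apply/cvgrPdist_lt => e e0; near=> t.
have t0 : (0 < t)%N by near: t; exists 1%N.
have mt : e^-1 < (m t)%:R.
  apply: (@lt_le_trans _ _ t%:R); last by rewrite ler_nat.
  apply: (@lt_le_trans _ _ (Num.bound e^-1)%:R).
    by apply: archi_boundP; rewrite invr_ge0 ltW.
  by rewrite ler_nat; near: t; exists (Num.bound e^-1).
have m0 : 0 < (m t)%:R :> R by apply: lt_trans mt; rewrite invr_gt0.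
by rewrite sub0r normrN ger0_norm ?invr_ge0 ?ltW // -[e]invrK ltf_pV2 // posrE invr_gt0.
Unshelve. all: by end_near. Qed.

(** One [l] serves every sequence and every exponent: the factor [0 ^+ (r - s)], with [s] the rank
    of N, is 1 for [r = s] and 0 for larger [r]. The index 0 is left out because [p^0 = 1]. *)
Lemma wset_ratio_cvg (R : realType) q (M : affine_monoid q) p : (1 < p)%N ->
  wset M p 0 -> exists l : R, forall (m : nat -> nat) r,
    (forall t, (t <= m t)%N) -> (forall t, (0 < t)%N -> (1 < m t)%N /\ wset M (m t) 0) ->
    (mrank (face_monoid M) <= r)%N ->
    ((size (wseq M (m t)))%:R / (m t)%:R ^+ r : R) @[t --> \oo] -->
      l * 0 ^+ (r - mrank (face_monoid M)).
Proof.
move=> p1 Wp; have [l lP] := face_ratio_cvg R p1 Wp; exists l => m r tm mW sr.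
set s := mrank _ in sr *.
have fr : (face_ratio R M (m t)) @[t --> \oo] --> l.
  apply/cvgrPdist_lt => e /lP[n0 n0P]; near=> t.
  have t0 : (0 < t)%N by near: t; exists 1%N.
  have [m1 Wm] := mW t t0; rewrite distrC; apply: n0P => //.
  by apply: leq_trans (tm t); near: t; exists n0.
have inv : (((m t)%:R^-1 : R) ^+ (r - s)) @[t --> \oo] --> (0 : R) ^+ (r - s).
  apply: (@cvg_comp _ _ _ (fun t => (m t)%:R^-1 : R) (fun x => x ^+ (r - s))).
    exact: invn_cvg0.
  exact: exprn_continuous.
apply: cvg_trans (cvgM fr inv); apply: near_eq_cvg.
near=> t; have t0 : (0 < t)%N by near: t; exists 1%N.
have [m1 _] := mW t t0; have m0 : (m t)%:R != 0 :> R by rewrite pnatr_eq0 -lt0n ltnW.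
rewrite /face_ratio -/s /= exprVn -mulrA -invfM -exprD subnKC //.
Unshelve. all: by end_near. Qed.

Lemma Aset_unbounded q (M : affine_monoid q) p : Aset M p ->
  forall n, exists2 m, (n <= m)%N & Aset M m.
Proof.
move=> /AsetP[p1 Wp] n; exists (p ^ n.+1)%N.
  by rewrite (leq_trans (leqnSn n)) // ltnW // ltn_expl.
by apply/AsetP; split; [rewrite -(expn0 p) ltn_exp2l|exact: wset0X].
Qed.

Section Dimensions.
Variables (k : fieldType) (q : nat) (M : affine_monoid q) (p : nat).
Variable chkp : p \in [pchar k].

Lemma sdimE : wset M p 0 -> sdim M chkp = mrank (face_monoid M).
Proof.
move=> Wp; rewrite /sdim split_primeE //.
apply: krull_dim_face_ideal; first exact: face_monoid_am.
exact: divisor_closed_face (prime_gt1 (pcharf_prime chkp)) Wp.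
Qed.

(** The zero ideal is the face ideal of M, the largest face. *)
Lemma ring_dimE : ring_dim k M = mrank (am_set M).
Proof.
rewrite -(@krull_dim_face_ideal k q M (am_set M)) //; last exact: divisor_closed_am.
rewrite /ring_dim; congr krull_dim; rewrite eqEsubset; split=> f.
  by move=> /= -> v _; exact: cf0.
move=> fM /=; apply/cfP => v; rewrite cf0.
by have [/fM//|/cf_out] := pselect (am_set M v).
Qed.

End Dimensions.

Theorem proposition5p8 (R : realType) (k : fieldType) (q : nat)
    (hq : (0 < q)%N) (M : affine_monoid q) :
  (forall (p : nat) (chkp : p \in [pchar k]), Aset M p ->
     [/\ cvgn (mpr_seq R M), cvgn (fsplit_seq M chkp R)
       & mpr R M = F_splitting_ratio M chkp R]) /\
  (forall (p : nat) (chkp : p \in [pchar k]), normal_monoid R M ->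
     [/\ cvgn (mps_seq R M), cvgn (fsig_seq M chkp R)
       & mps R M = F_signature M chkp R]).
Proof.
have nthE p : Aset M p -> forall t,
    [/\ (t <= nth_elt (Aset M) t)%N, (1 < nth_elt (Aset M) t)%N
      & wset M (nth_elt (Aset M) t) 0].
  move=> Ap t; have [/AsetP[m1 Wm] tm] := nth_eltP t (Aset_unbounded Ap).
  by split.
have powE p : Aset M p -> forall t, (0 < t)%N -> (1 < p ^ t)%N /\ wset M (p ^ t) 0.
  move=> /AsetP[p1 Wp] [//|t] _; split; last exact: wset0X.
  by rewrite -(expn0 p) ltn_exp2l.
(* Both claims compare the same ratio along the enumeration of A(M) and along the powers of [p]; [r]
   is the rank of N for the splitting ratio and that of M for the signature. *)
have both p (chkp : p \in [pchar k]) (u v : R^nat) r : Aset M p ->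
    (mrank (face_monoid M) <= r)%N ->
    (forall t, u t = (cardV (nth_elt (Aset M) t) M)%:R / (nth_elt (Aset M) t)%:R ^+ r) ->
    (forall e, v e = (split_codim M chkp e)%:R / p%:R ^+ (e * r)) ->
    [/\ cvgn u, cvgn v & limn u = limn v].
  move=> Ap sr uE vE; have [p1 Wp] := (AsetP M p).1 Ap.
  have [l lP] := wset_ratio_cvg R p1 Wp.
  have ul : u @ \oo --> l * 0 ^+ (r - mrank (face_monoid M)).
    have -> : u = (fun t => (size (wseq M (nth_elt (Aset M) t)))%:R /
        (nth_elt (Aset M) t)%:R ^+ r).
      apply/funext => t; have [_ m1 _] := nthE p Ap t.
      by rewrite uE cardVE // ltnW.
    by apply: lP => // t; have [] := nthE p Ap t.
  have vl : v @ \oo --> l * 0 ^+ (r - mrank (face_monoid M)).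
    have -> : v = (fun e => (size (wseq M (p ^ e)))%:R / (p ^ e)%:R ^+ r).
      by apply/funext => e; rewrite vE split_codimE natrX exprM.
    apply: lP => // t; last exact: powE.
    by rewrite ltnW // ltn_expl.
  split; first by apply/cvg_ex; eexists; exact: ul.
    by apply/cvg_ex; eexists; exact: vl.
  by rewrite (cvg_lim _ ul) // (cvg_lim _ vl).
split=> p chkp.
  move=> Ap; have [p1 Wp] := (AsetP M p).1 Ap.
  apply: (both p chkp _ _ (mrank (face_monoid M))) => // [t|e].
    by rewrite /mpr_seq (mpdimE R p1 Wp).
  by rewrite /fsplit_seq sdimE.
move=> nM; have Ap := normal_Aset nM (prime_gt1 (pcharf_prime chkp)).
apply: (both p chkp _ _ (mrank (am_set M))) => //.
  by apply: mrankS; exact: face_monoid_am.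
by move=> e; rewrite /fsig_seq ring_dimE.
Qed.
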